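(* Let $q_1,q_2,Y_1,Y_2,\rho>0$ and initial prices $p_{1,0},p_{2,0}>0$ satisfy $p_{2,0}q_2<p_{1,0}q_1$, and suppose $(Y_1,Y_2)$ lies in zone II: $Y_1<p_{1,0}q_1$, $p_{2,0}q_2\le Y_2$. Zone II is divided into: Zone II-1: $Y_1<p_{1,0}q_1$, $p_{2,0}q_2\le Y_2$, $q_1>\frac{Y_1}{p_{1,0}}+\frac{Y_2}{p_{1,0}'}$ (strictly below $\ell_{1,0}$); Zone II-2: $Y_1<p_{1,0}q_1$, $p_{2,0}q_2\le Y_2$, $q_2>\frac1{p_{2,0}}\big[Y_2-p_{1,0}'\big(q_1-\frac{Y_1}{p_{1,0}}\big)\big]$ (strictly below $\ell_{4,0}$), $\frac{Y_1}{p_{1,0}}+\frac{Y_2}{p_{1,0}'}\ge q_1$ (on or above $\ell_{1,0}$); Zone II-3: $Y_1<p_{1,0}q_1$, $p_{2,0}q_2<Y_2$, $q_2\le\frac1{p_{2,0}}\big[Y_2-p_{1,0}'\big(q_1-\frac{Y_1}{p_{1,0}}\big)\big]$ (on or above $\ell_{4,0}$). Write $\Delta p=p_{1,0}-p_{2,0}$. Then: a) In zone II-3 there exists a unique NE, $\big(\frac{Y_1}{p_{1,0}},0,q_1-\frac{Y_1}{p_{1,0}},q_2\big)$, for which either $(Y_1,Y_2)\in\ell_{4,0}$, which is a p.e., or $(Y_1,Y_2)$ is strictly above $\ell_{4,0}$, and then after one upward adjustment in $p_{2,0}$ we obtain $(Y_1,Y_2)\in\ell_{4,1}$ (the p.e.s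 of this type are the $\ell_4$-equilibria). b) In zone II-2 there exist two types of NE: I) for $\Delta p<-\rho$: $\Big(\frac{Y_1}{p_{1,0}},0,q_1-\frac{Y_1}{p_{1,0}},\frac{Y_2-p_{1,0}'(q_1-Y_1/p_{1,0})}{p_{2,0}}\Big)$; II) for $\Delta p\ge-\rho$: $\Big(\frac{Y_1}{p_{1,0}},0,\frac{Y_2-p_{2,0}q_2}{p_{1,0}'},q_2\Big)$. For the two types of NE the following price adjustment patterns obtain. In case I): 1) when $(Y_1,Y_2)$ is strictly above $\ell_{1,0}$, after one downward adjustment step in $p_{2,0}$ an $\ell_4$-equilibrium is reached; 2) when $(Y_1,Y_2)$ lies on $\ell_{1,0}$, the price $p_{2,0}$ is reduced to $p_{2,1}=0$ and a degenerate $\ell_1$-equilibrium is reached. In case II): 1) when $Y_2=p_{2,0}q_2$, after one downward adjustment in $p_{1,0}$ a p.e. of type $E$ is reached; 2) when $Y_2>p_{2,0}q_2$, let $$k=\frac1{2q_1}\Big[\sqrt{(\rho q_1-Y_1-Y_2+p_{2,0}q_2)^2+4q_1\rho Y_1}-(\rho q_1-Y_1-Y_2+p_{2,0}q_2)\Big];$$ then, depending on whether 2.1) $p_{2,0}-\rho\le k<p_{1,0}$ or 2.2) $k<p_{2,0}-\rho<p_{1,0}$, we have respectively: in 2.1), an infinite downward adjustment process in $p_{1,t}$ for which $\lim_{t\to\infty}p_{1,t}=k$ (the system of two economies tends to a degenerate $\ell_4$-equilibrium, with limit line $\ell_{4,\infty}:\ \tilde Y_1+\frac{k}{k+\rho}\tilde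 Y_2=kq_1+\frac{k}{k+\rho}p_{2,0}q_2$); in 2.2), after $s$ downward adjustments of the first price, the situation described in case I) is reached; here the number $s\in\mathbb N$ is determined by the condition $p_{2,0}-\rho\in\big[g^s(p_{1,0}),g^{s-1}(p_{1,0})\big]$, where $g(x)=\frac1{q_1}\big[Y_1+(Y_2-p_{2,0}q_2)\frac{x}{x+\rho}\big]$ and $g^s$ is the $s$-fold iterate of $g$. c) In zone II-1 there are two types of NE: I) for $\Delta p<-\rho$: $\Big(\frac{Y_1}{p_{1,0}},0,\frac{Y_2}{p_{1,0}'},0\Big)$; II) for $\Delta p\ge-\rho$: $\Big(\frac{Y_1}{p_{1,0}},0,\frac{Y_2-p_{2,0}q_2}{p_{1,0}'},q_2\Big)$. For the two types of NE the following price adjustment patterns obtain. In case I) there is an infinite downward adjustment process in $p_{1,t}$, under which it tends monotonically to $$p_{1,\infty}=\frac1{2q_1}\Big(Y_1+Y_2-\rho q_1+\sqrt{(Y_1+Y_2-\rho q_1)^2+4\rho q_1Y_1}\Big),$$ while $p_{2,t}=0$ for all $t\ge1$ (the system of two economies tends to a degenerate $\ell_1$-equilibrium, with limit line $\frac{\tilde Y_1}{p_{1,\infty}}+\frac{\tilde Y_2}{p_{1,\infty}+\rho}=q_1$). In case II) the price adjustment pattern is the one described in case II) of b).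
   Context: Model. Fix $q_1,q_2>0$ (quantities supplied each period in regions I and II), $Y_1,Y_2>0$ (per-period incomes of consumers I and II) and $\rho>0$ (transportation cost). For prices $p_1,p_2\ge 0$ write $p_i'=p_i+\rho$ (and $p_{i,t}'=p_{i,t}+\rho$). In each period the following game is played. Consumer I chooses $(\alpha,\beta)\in S_1=\{\alpha,\beta\ge0,\ \alpha p_1+\beta p_2'\le Y_1\}$ (orders in regions I and II); consumer II chooses $(\gamma,\delta)\in S_2=\{\gamma,\delta\ge0,\ \gamma p_1'+\delta p_2\le Y_2\}$ (orders in regions I and II). Payoffs: $P_1=\min(\alpha,q_1)+\min(\beta,\max(0,q_2-\delta))$ and $P_2=\min(\delta,q_2)+\min(\gamma,\max(0,q_1-\alpha))$. Selected best replies. Given $(\gamma,\delta)$, consumer I's best reply is the maximizer of $P_1$ over $S_1$ that among all maximizers minimizes the expenditure $p_1\alpha+p_2'\beta$, and among those has the largest home order $\alpha$; if $p_1=0$ the home order is instead set to $\alpha=q_1$. Given $(\alpha,\beta)$, consumer II's best reply is the maximizer of $P_2$ over $S_2$ that minimizes $p_1'\gamma+p_2\delta$, and among those has the largest home order $\delta$; if $p_2=0$ the home order is set to $\delta=q_2$. A Nash equilibrium (NE) at prices $(p_1,p_2)$ is a quadruple $(\alpha,\beta,\gamma,\delta)$ in which each consumer's orders are the selected best reply to the other's. The NEs in the claim are those at the initial prices. Price dynamics (discrete time). At time $t$, with prices $p_{1,t},p_{2,t}$ and corresponding NE $(\alpha,\beta,\gamma,\delta)$, put $q_1^{cons}=\alpha+\gamma$,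 $q_2^{cons}=\beta+\delta$, $Y_1^{res}=Y_1-p_{2,t}'\beta$, $Y_2^{res}=Y_2-p_{1,t}'\gamma$. If $q_i^{cons}<q_i$, then $p_{i,t+1}=p_{i,t}q_i^{cons}/q_i$ (downward adjustment); if $Y_i^{res}>p_{i,t}q_i$, then $p_{i,t+1}=Y_i^{res}/q_i$ (upward adjustment); otherwise $p_{i,t+1}=p_{i,t}$. Lines in the $(\tilde Y_1,\tilde Y_2)$-plane at prices $(p_1,p_2)$: $\ell_1:\ q_1=\frac{\tilde Y_1}{p_1}+\frac{\tilde Y_2}{p_1'}$; $\ell_4:\ p_1'q_1+p_2q_2=\frac{p_1'}{p_1}\tilde Y_1+\tilde Y_2$. The lines at time-$t$ prices are denoted $\ell_{i,t}$. A point is above (below) a line if the side containing $\tilde Y_1,\tilde Y_2$ is larger (smaller) than the other side. A point of equilibrium (p.e.) for prices is a pair $(p_1,p_2)$ whose NE satisfies $\alpha+\gamma=q_1$, $\beta+\delta=q_2$, $p_1\alpha+p_2'\beta=Y_1$, $p_1'\gamma+p_2\delta=Y_2$; then prices remain unchanged. A p.e. of type $E$ is a p.e. with $p_i=Y_i/q_i$, $i=1,2$, and NE $(q_1,0,0,q_2)$. An $\ell_4$-equilibrium is a p.e. with $Y_1<p_1q_1$, $p_2q_2<Y_2$ and $(Y_1,Y_2)\in\ell_4$. A degenerate $\ell_1$-equilibrium is a p.e. with $p_1>0$, $p_2=0$ and $(Y_1,Y_2)\in\ell_1$. The system ''tends to'' a degenerate equilibrium with a given limit line if the prices converge through an infinite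 adjustment process and $(Y_1,Y_2)$ lies on the line obtained from $\ell_1$, respectively $\ell_4$, at the limit prices. *)

(* Defs.v *)
From Stdlib Require Export Reals Lra.
From Coquelicot Require Export Coquelicot.
Open Scope R_scope.

Record economy := Economy { q1 : R; q2 : R; Y1 : R; Y2 : R; rho : R }.

Record prices := Prices { p1 : R; p2 : R }.

(* [alpha], [beta]: orders of consumer I in regions I and II;
   [gamma], [delta]: orders of consumer II in regions I and II. *)
Record orders := Orders { alpha : R; beta : R; gamma : R; delta : R }.

(* Price paid by the consumer of the other region. *)
Definition p1' (e : economy) (p : prices) : R := p1 p + rho e.
Definition p2' (e : economy) (p : prices) : R := p2 p + rho e.

Definition S1 (e : economy) (p : prices) (a b : R) : Prop :=
  0 <= a /\ 0 <= b /\ a * p1 p + b * p2' e p <= Y1 e.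
Definition S2 (e : economy) (p : prices) (c d : R) : Prop :=
  0 <= c /\ 0 <= d /\ c * p1' e p + d * p2 p <= Y2 e.

Definition P1 (e : economy) (x : orders) : R :=
  Rmin (alpha x) (q1 e) + Rmin (beta x) (Rmax 0 (q2 e - delta x)).
Definition P2 (e : economy) (x : orders) : R :=
  Rmin (delta x) (q2 e) + Rmin (gamma x) (Rmax 0 (q1 e - alpha x)).

Definition maximizer_I (e : economy) (p : prices) (c d a b : R) : Prop :=
  S1 e p a b /\
  forall a' b', S1 e p a' b' -> P1 e (Orders a' b' c d) <= P1 e (Orders a b c d).
Definition maximizer_II (e : economy) (p : prices) (a b c d : R) : Prop :=
  S2 e p c d /\
  forall c' d', S2 e p c' d' -> P2 e (Orders a b c' d') <= P2 e (Orders a b c d).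

Definition cheapest_I (e : economy) (p : prices) (c d a b : R) : Prop :=
  maximizer_I e p c d a b /\
  forall a' b', maximizer_I e p c d a' b' ->
    p1 p * a + p2' e p * b <= p1 p * a' + p2' e p * b'.
Definition cheapest_II (e : economy) (p : prices) (a b c d : R) : Prop :=
  maximizer_II e p a b c d /\
  forall c' d', maximizer_II e p a b c' d' ->
    p1' e p * c + p2 p * d <= p1' e p * c' + p2 p * d'.

(* [best_reply_I e p c d a b]: the selected best reply to [(gamma, delta) = (c, d)]
   is [(alpha, beta) = (a, b)]. *)
Definition best_reply_I (e : economy) (p : prices) (c d a b : R) : Prop :=
  cheapest_I e p c d a b /\
  (p1 p = 0 -> a = q1 e) /\
  (p1 p <> 0 -> forall a' b', cheapest_I e p c d a' b' -> a' <= a).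
Definition best_reply_II (e : economy) (p : prices) (a b c d : R) : Prop :=
  cheapest_II e p a b c d /\
  (p2 p = 0 -> d = q2 e) /\
  (p2 p <> 0 -> forall c' d', cheapest_II e p a b c' d' -> d' <= d).

Definition NE (e : economy) (p : prices) (x : orders) : Prop :=
  best_reply_I e p (gamma x) (delta x) (alpha x) (beta x) /\
  best_reply_II e p (alpha x) (beta x) (gamma x) (delta x).

Definition q1cons (x : orders) : R := alpha x + gamma x.
Definition q2cons (x : orders) : R := beta x + delta x.
Definition Y1res (e : economy) (p : prices) (x : orders) : R := Y1 e - p2' e p * beta x.
Definition Y2res (e : economy) (p : prices) (x : orders) : R := Y2 e - p1' e p * gamma x.

(* At an NE the two conditions exclude each other, so the order of the tests is
   immaterial. *)
Definition next_price (pr q qcons Yres : R) : R :=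
  if Rlt_dec qcons q then pr * qcons / q
  else if Rlt_dec (pr * q) Yres then Yres / q
  else pr.

Definition adjust (e : economy) (p : prices) (x : orders) : prices :=
  Prices (next_price (p1 p) (q1 e) (q1cons x) (Y1res e p x))
         (next_price (p2 p) (q2 e) (q2cons x) (Y2res e p x)).

Definition price_process (e : economy) (P : nat -> prices) : Prop :=
  forall t, exists x, NE e (P t) x /\ P (S t) = adjust e (P t) x.

Definition down1 (e : economy) (P : nat -> prices) (t : nat) : Prop :=
  exists x, NE e (P t) x /\ q1cons x < q1 e /\
    p1 (P (S t)) = p1 (P t) * q1cons x / q1 e.
Definition down2 (e : economy) (P : nat -> prices) (t : nat) : Prop :=
  exists x, NE e (P t) x /\ q2cons x < q2 e /\
    p2 (P (S t)) = p2 (P t) * q2cons x / q2 e.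
Definition up2 (e : economy) (P : nat -> prices) (t : nat) : Prop :=
  exists x, NE e (P t) x /\ p2 (P t) * q2 e < Y2res e (P t) x /\
    p2 (P (S t)) = Y2res e (P t) x / q2 e.

Definition shift (s : nat) (P : nat -> prices) : nat -> prices :=
  fun t => P (s + t)%nat.

Definition l1_rhs (e : economy) (p : prices) (y1 y2 : R) : R :=
  y1 / p1 p + y2 / p1' e p.
Definition on_l1 (e : economy) (p : prices) (y1 y2 : R) : Prop :=
  q1 e = l1_rhs e p y1 y2.
Definition above_l1 (e : economy) (p : prices) (y1 y2 : R) : Prop :=
  q1 e < l1_rhs e p y1 y2.

Definition l4_lhs (e : economy) (p : prices) : R := p1' e p * q1 e + p2 p * q2 e.
Definition l4_rhs (e : economy) (p : prices) (y1 y2 : R) : R :=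
  p1' e p / p1 p * y1 + y2.
Definition on_l4 (e : economy) (p : prices) (y1 y2 : R) : Prop :=
  l4_lhs e p = l4_rhs e p y1 y2.
Definition above_l4 (e : economy) (p : prices) (y1 y2 : R) : Prop :=
  l4_lhs e p < l4_rhs e p y1 y2.

Definition zone_II (e : economy) (p : prices) : Prop :=
  Y1 e < p1 p * q1 e /\ p2 p * q2 e <= Y2 e.
Definition zone_II_1 (e : economy) (p : prices) : Prop :=
  Y1 e < p1 p * q1 e /\ p2 p * q2 e <= Y2 e /\
  q1 e > Y1 e / p1 p + Y2 e / p1' e p.
Definition zone_II_2 (e : economy) (p : prices) : Prop :=
  Y1 e < p1 p * q1 e /\ p2 p * q2 e <= Y2 e /\
  q2 e > 1 / p2 p * (Y2 e - p1' e p * (q1 e - Y1 e / p1 p)) /\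
  Y1 e / p1 p + Y2 e / p1' e p >= q1 e.
Definition zone_II_3 (e : economy) (p : prices) : Prop :=
  Y1 e < p1 p * q1 e /\ p2 p * q2 e < Y2 e /\
  q2 e <= 1 / p2 p * (Y2 e - p1' e p * (q1 e - Y1 e / p1 p)).

Definition pe (e : economy) (p : prices) : Prop :=
  exists x, unique (NE e p) x /\
    alpha x + gamma x = q1 e /\ beta x + delta x = q2 e /\
    p1 p * alpha x + p2' e p * beta x = Y1 e /\
    p1' e p * gamma x + p2 p * delta x = Y2 e.

Definition pe_type_E (e : economy) (p : prices) : Prop :=
  pe e p /\ p1 p = Y1 e / q1 e /\ p2 p = Y2 e / q2 e /\
  unique (NE e p) (Orders (q1 e) 0 0 (q2 e)).

Definition l4_equilibrium (e : economy) (p : prices) : Prop :=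
  pe e p /\ Y1 e < p1 p * q1 e /\ p2 p * q2 e < Y2 e /\ on_l4 e p (Y1 e) (Y2 e).

Definition degenerate_l1_equilibrium (e : economy) (p : prices) : Prop :=
  pe e p /\ 0 < p1 p /\ p2 p = 0 /\ on_l1 e p (Y1 e) (Y2 e).

Definition tends_to_degenerate (line : economy -> prices -> R -> R -> Prop)
    (e : economy) (P : nat -> prices) (pinf : prices) : Prop :=
  (forall t, P (S t) <> P t) /\
  is_lim_seq (fun t => p1 (P t)) (p1 pinf) /\
  is_lim_seq (fun t => p2 (P t)) (p2 pinf) /\
  line e pinf (Y1 e) (Y2 e).

Definition NE_a (e : economy) (p : prices) : orders :=
  Orders (Y1 e / p1 p) 0 (q1 e - Y1 e / p1 p) (q2 e).
Definition NE_b_I (e : economy) (p : prices) : orders :=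
  Orders (Y1 e / p1 p) 0 (q1 e - Y1 e / p1 p)
    ((Y2 e - p1' e p * (q1 e - Y1 e / p1 p)) / p2 p).
Definition NE_c_I (e : economy) (p : prices) : orders :=
  Orders (Y1 e / p1 p) 0 (Y2 e / p1' e p) 0.
Definition NE_II (e : economy) (p : prices) : orders :=
  Orders (Y1 e / p1 p) 0 ((Y2 e - p2 p * q2 e) / p1' e p) (q2 e).

(* The patterns below describe a price process from its time 0 on; they are applied
   to shifted processes as well. *)

Definition pattern_b_I (e : economy) (P : nat -> prices) : Prop :=
  (above_l1 e (P 0%nat) (Y1 e) (Y2 e) ->
     down2 e P 0 /\ p1 (P 1%nat) = p1 (P 0%nat) /\ l4_equilibrium e (P 1%nat)) /\
  (on_l1 e (P 0%nat) (Y1 e) (Y2 e) ->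
     down2 e P 0 /\ p1 (P 1%nat) = p1 (P 0%nat) /\ p2 (P 1%nat) = 0 /\
     degenerate_l1_equilibrium e (P 1%nat)).

Definition p1_inf (e : economy) : R :=
  1 / (2 * q1 e) *
  (Y1 e + Y2 e - rho e * q1 e
   + sqrt ((Y1 e + Y2 e - rho e * q1 e) ^ 2 + 4 * rho e * q1 e * Y1 e)).

Definition pattern_c_I (e : economy) (P : nat -> prices) : Prop :=
  (forall t, down1 e P t) /\
  (forall t, p1 (P (S t)) < p1 (P t)) /\
  is_lim_seq (fun t => p1 (P t)) (p1_inf e) /\
  (forall t, (1 <= t)%nat -> p2 (P t) = 0) /\
  tends_to_degenerate on_l1 e P (Prices (p1_inf e) 0) /\
  (forall y1 y2, on_l1 e (Prices (p1_inf e) 0) y1 y2 <->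
     y1 / p1_inf e + y2 / (p1_inf e + rho e) = q1 e).

Definition in_case_b_I (e : economy) (P : nat -> prices) : Prop :=
  zone_II_2 e (P 0%nat) /\ p1 (P 0%nat) - p2 (P 0%nat) < - rho e /\
  unique (NE e (P 0%nat)) (NE_b_I e (P 0%nat)) /\ pattern_b_I e P.

Definition in_case_c_I (e : economy) (P : nat -> prices) : Prop :=
  zone_II_1 e (P 0%nat) /\ p1 (P 0%nat) - p2 (P 0%nat) < - rho e /\
  unique (NE e (P 0%nat)) (NE_c_I e (P 0%nat)) /\ pattern_c_I e P.

Definition k (e : economy) (p20 : R) : R :=
  1 / (2 * q1 e) *
  (sqrt ((rho e * q1 e - Y1 e - Y2 e + p20 * q2 e) ^ 2 + 4 * q1 e * rho e * Y1 e)
   - (rho e * q1 e - Y1 e - Y2 e + p20 * q2 e)).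

Definition g (e : economy) (p20 x : R) : R :=
  1 / q1 e * (Y1 e + (Y2 e - p20 * q2 e) * (x / (x + rho e))).

Definition s_condition (e : economy) (p0 : prices) (s : nat) : Prop :=
  (1 <= s)%nat /\
  Nat.iter s (g e (p2 p0)) (p1 p0) <= p2 p0 - rho e
    <= Nat.iter (s - 1) (g e (p2 p0)) (p1 p0).

(* When [p2 p0 - rho e] is exactly the [s]-th iterate, both [s] and [s + 1] satisfy
   [s_condition]; the price difference after [s] steps is then [- rho e], and only
   the step [s + 1] leads to case I.  Apart from this tie [s] is unique. *)
Definition reaches_case_I (case_I : economy -> (nat -> prices) -> Prop)
    (e : economy) (P : nat -> prices) : Prop :=
  exists s : nat,
    s_condition e (P 0%nat) s /\
    (forall s', s_condition e (P 0%nat) s' ->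
       Nat.iter s' (g e (p2 (P 0%nat))) (p1 (P 0%nat)) <> p2 (P 0%nat) - rho e ->
       s' = s) /\
    (forall t, (t < s)%nat -> down1 e P t /\ p2 (P (S t)) = p2 (P t)) /\
    case_I e (shift s P).

Definition pattern_II (case_I : economy -> (nat -> prices) -> Prop)
    (e : economy) (P : nat -> prices) : Prop :=
  let p10 := p1 (P 0%nat) in
  let p20 := p2 (P 0%nat) in
  let k := k e p20 in
  (Y2 e = p20 * q2 e ->
     down1 e P 0 /\ p2 (P 1%nat) = p20 /\ pe_type_E e (P 1%nat)) /\
  (p20 * q2 e < Y2 e ->
     (p20 - rho e <= k < p10 ->
        (forall t, down1 e P t /\ p2 (P (S t)) = p2 (P t)) /\
        is_lim_seq (fun t => p1 (P t)) k /\
        tends_to_degenerate on_l4 e P (Prices k p20) /\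
        (forall y1 y2, on_l4 e (Prices k p20) y1 y2 <->
           y1 + k / (k + rho e) * y2 = k * q1 e + k / (k + rho e) * p20 * q2 e)) /\
     (k < p20 - rho e < p10 -> reaches_case_I case_I e P)).

(* Main.v *)
Require Import Defs.
From Stdlib Require Import Lia.

(** Both consumers solve the same problem: spend an income on a home good, of which
    a fixed quantity is useful, and on a foreign good, of which the useful quantity
    is what the other consumer leaves.  The selected best reply to this problem is
    unique, because two selected bundles agree on the home order and on the
    expenditure.  So equilibria are found by exhibiting replies.  In zone II consumer
    I always ends up spending the whole income at home: either home is not the
    dearer place, or consumer II takes all of region II and nothing is left abroad.
    Consumer II then buys first at home when [p2 <= p1 + rho] and first abroad
    otherwise ([NE_home_unique], [NE_abroad_unique]).

    With [L = (p1 + rho) (q1 - Y1 / p1)], the cost for consumer II of everything left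
    in region I ([leftover_cost]), the position of the incomes relative to the lines is
    a comparison with [L]: they lie below the first line iff [Y2 < L], and below the
    fourth line iff [Y2 - p2 q2 < L].  When [L = Y2 - p2 q2] both incomes are exactly exhausted and
    both markets clear, which gives all the points of equilibrium that are reached in
    finitely many steps ([pe_of_balance]).

    If consumer II saturates region II and still cannot buy all of region I, then [p2]
    stays and [p1] becomes [g p1].  The number [k] is the positive fixed point of [g],
    and [g x - k] is a multiple of [x - k] with a factor between [0] and a constant
    smaller than [1] ([g_gap], [rate_bounds]).  Hence being below the fourth line is
    the same as [k < p1], this property persists (for [Y2 > p2 q2]), and [p1]
    decreases to [k] geometrically.
    The only thing that may interrupt the descent is that [p1] passes below
    [p2 - rho], where consumer II starts to prefer region I; that happens exactly when
    [k < p2 - rho].  The process with [p2 = 0] is the same recursion, since the limit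
    price [p1_inf] is the value of [k] at zero ([p1_inf_k]). *)

(** * The decision problem of one consumer *)

(** [h] and [f] are the home and foreign prices, [Q] and [V] the useful quantities
    at home and abroad, and [Y] is the income. *)
Definition feasible (h f Y x y : R) : Prop :=
  0 <= x /\ 0 <= y /\ x * h + y * f <= Y.

Definition utility (Q V x y : R) : R := Rmin x Q + Rmin y V.

Definition optimal (h f Q V Y x y : R) : Prop :=
  feasible h f Y x y /\
  forall x' y', feasible h f Y x' y' -> utility Q V x' y' <= utility Q V x y.

Definition cheapest (h f Q V Y x y : R) : Prop :=
  optimal h f Q V Y x y /\
  forall x' y', optimal h f Q V Y x' y' -> h * x + f * y <= h * x' + f * y'.

Definition selected (h f Q V Y x y : R) : Prop :=
  cheapest h f Q V Y x y /\
  (h = 0 -> x = Q) /\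
  (h <> 0 -> forall x' y', cheapest h f Q V Y x' y' -> x' <= x).

Lemma best_reply_I_selected (e : economy) (p : prices) (c d a b : R) :
  best_reply_I e p c d a b <->
  selected (p1 p) (p2' e p) (q1 e) (Rmax 0 (q2 e - d)) (Y1 e) a b.
Proof. reflexivity. Qed.

Lemma best_reply_II_selected (e : economy) (p : prices) (a b c d : R) :
  best_reply_II e p a b c d <->
  selected (p2 p) (p1' e p) (q2 e) (Rmax 0 (q1 e - a)) (Y2 e) d c.
Proof.
  assert (hS : forall c d, S2 e p c d <-> feasible (p2 p) (p1' e p) (Y2 e) d c).
  { intros c0 d0; unfold S2, feasible; rewrite (Rplus_comm (c0 * _)); tauto. }
  assert (hM : forall c d, maximizer_II e p a b c d <->
      optimal (p2 p) (p1' e p) (q2 e) (Rmax 0 (q1 e - a)) (Y2 e) d c).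
  { intros c0 d0; unfold maximizer_II, optimal; rewrite hS.
    split; intros [H K]; (split; [exact H|]); intros u v Huv;
      apply (K v u), hS, Huv. }
  assert (hC : forall c d, cheapest_II e p a b c d <->
      cheapest (p2 p) (p1' e p) (q2 e) (Rmax 0 (q1 e - a)) (Y2 e) d c).
  { intros c0 d0; unfold cheapest_II, cheapest; rewrite hM.
    split; intros [H K]; (split; [exact H|]); intros u v Huv;
      apply hM in Huv; specialize (K _ _ Huv); lra. }
  unfold best_reply_II, selected; rewrite hC.
  split; intros (H & H0 & K); (split; [exact H|split; [exact H0|]]);
    intros hp u v Huv; apply (K hp v u), hC, Huv.
Qed.

(** The home order is fixed either by the rule for a zero price or by maximality;
    equal minimal expenditures then fix the foreign order, as [f] is positive. *)
Lemma selected_unique (h f Q V Y x y x' y' : R) :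
  0 < f -> selected h f Q V Y x y -> selected h f Q V Y x' y' -> x = x' /\ y = y'.
Proof.
  intros hf (C & Z & M) (C' & Z' & M').
  assert (hx : x = x').
  { destruct (Req_dec h 0) as [h0|h0]; [rewrite Z, Z'; auto|].
    specialize (M h0 _ _ C'); specialize (M' h0 _ _ C); lra. }
  split; [exact hx|subst x'].
  destruct C as [O C], C' as [O' C'].
  specialize (C _ _ O'); specialize (C' _ _ O).
  apply Rmult_eq_reg_l with f; lra.
Qed.

(** It is enough to compare with feasible bundles in lexicographic order: utility,
    then expenditure, then home order. *)
Lemma selected_intro (h f Q V Y x y : R) :
  feasible h f Y x y -> (h = 0 -> x = Q) ->
  (forall x' y', feasible h f Y x' y' ->
     utility Q V x' y' <= utility Q V x y /\
     (utility Q V x' y' = utility Q V x y ->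
        h * x + f * y <= h * x' + f * y' /\
        (h <> 0 -> h * x' + f * y' = h * x + f * y -> x' <= x))) ->
  selected h f Q V Y x y.
Proof.
  intros F Z H.
  assert (O : optimal h f Q V Y x y) by (split; [exact F|intros; apply H; auto]).
  assert (T : forall x' y', optimal h f Q V Y x' y' ->
            utility Q V x' y' = utility Q V x y).
  { intros x' y' [F' O']; apply Rle_antisym; [apply H; auto|apply O', F]. }
  assert (C : cheapest h f Q V Y x y).
  { split; [exact O|]; intros x' y' O'.
    apply H; [apply O'|apply T, O']. }
  split; [exact C|split; [exact Z|]].
  intros h0 x' y' [O' C'].
  apply (H x' y'); [apply O'|apply T, O'|exact h0|].
  apply Rle_antisym; [apply C', O|apply C, O'].
Qed.

Lemma Rmin_cases (x y : R) : Rmin x y = x /\ x <= y \/ Rmin x y = y /\ y <= x.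
Proof. unfold Rmin; destruct (Rle_dec x y); [left|right]; lra. Qed.

(** Only the useful part [(u, v)] of a bundle counts for utility, and it costs at
    most as much as the bundle; so optimality reduces to linear inequalities
    between [u], [v] and the budget. *)
Lemma served_bounds (h f Q V Y x y : R) :
  0 <= h -> 0 <= f -> 0 <= Q -> 0 <= V -> feasible h f Y x y ->
  let u := Rmin x Q in let v := Rmin y V in
  (0 <= u <= x /\ u <= Q) /\ (0 <= v <= y /\ v <= V) /\
  h * u <= h * x /\ f * v <= f * y /\ h * x + f * y <= Y.
Proof.
  intros hh hf hQ hV (hx & hy & hb) u v.
  assert (hu : 0 <= u <= x /\ u <= Q)
    by (unfold u; destruct (Rmin_cases x Q) as [[-> ?]|[-> ?]]; lra).
  assert (hv : 0 <= v <= y /\ v <= V)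
    by (unfold v; destruct (Rmin_cases y V) as [[-> ?]|[-> ?]]; lra).
  split; [exact hu|split; [exact hv|split; [|split]]];
    try (apply Rmult_le_compat_l; lra); lra.
Qed.

(** When the foreign good is not cheaper, one unit of it never replaces a home unit
    with profit.  The quantitative form is [(f - h) u <= (f - h) Q]; when the income
    runs out, adding it to the budget of a bundle bounds its utility. *)
Lemma selected_home_saturated (h f Q V Y : R) :
  0 <= h -> 0 < f -> h <= f -> 0 <= Q -> 0 <= V -> h * Q <= Y ->
  selected h f Q V Y Q (Rmin V ((Y - h * Q) / f)).
Proof.
  intros hh hf hhf hQ hV hY.
  set (y := Rmin V ((Y - h * Q) / f)).
  assert (hw : f * ((Y - h * Q) / f) = Y - h * Q) by (field; lra).
  assert (hw0 : 0 <= (Y - h * Q) / f) by (apply Rdiv_le_0_compat; lra).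
  assert (hy : 0 <= y <= V /\ f * y <= Y - h * Q /\ (y = V \/ f * y = Y - h * Q)).
  { unfold y; destruct (Rmin_cases V ((Y - h * Q) / f)) as [[-> H]|[-> H]].
    - apply (Rmult_le_compat_l f) in H; lra.
    - lra. }
  clearbody y; clear hw hw0.
  assert (hU : utility Q V Q y = Q + y)
    by (unfold utility; rewrite !Rmin_left; lra).
  apply selected_intro; [unfold feasible; lra|auto|].
  intros x' y' F.
  pose proof (served_bounds h f Q V Y x' y' hh (Rlt_le _ _ hf) hQ hV F) as B.
  rewrite hU; unfold utility; cbv zeta in B.
  set (u := Rmin x' Q) in *; set (v := Rmin y' V) in *.
  destruct B as (hu & hv & hux & hvy & hb).
  destruct hy as (hy0 & hyb & [hyV|hyY]).
  - split; [lra|intros E].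
    assert (u = Q) by lra; assert (v = V) by lra.
    rewrite H in hux; rewrite H0 in hvy; subst y.
    split; [lra|intros h0 Ec].
    apply Rmult_le_reg_l with h; lra.
  - assert (hd : (f - h) * u <= (f - h) * Q) by (apply Rmult_le_compat_l; lra).
    split.
    + apply Rmult_le_reg_l with f; lra.
    + intros E; assert (Ef : f * (u + v) = f * (Q + y)) by (rewrite E; ring).
      split; [lra|intros h0 Ec].
      apply Rle_trans with u; [|lra].
      apply Rmult_le_reg_l with h; lra.
Qed.

(** The two alternatives share one reason: a useful foreign unit does not cost less
    than a home unit, trivially so if no foreign unit is useful. *)
Lemma selected_home_exhausts_income (h f Q V Y : R) :
  0 < h -> 0 < f -> h <= f \/ V = 0 -> 0 <= Q -> 0 <= V -> 0 <= Y -> Y <= h * Q ->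
  selected h f Q V Y (Y / h) 0.
Proof.
  intros hh hf hhf hQ hV hY0 hY.
  assert (hx : h * (Y / h) = Y) by (field; lra).
  assert (hx0 : 0 <= Y / h) by (apply Rdiv_le_0_compat; lra).
  assert (hxQ : Y / h <= Q) by (apply Rmult_le_reg_l with h; lra).
  set (x := Y / h) in *; clearbody x.
  assert (hU : utility Q V x 0 = x)
    by (unfold utility; rewrite !Rmin_left; lra).
  apply selected_intro; [unfold feasible; lra|lra|].
  intros x' y' F.
  pose proof (served_bounds h f Q V Y x' y' (Rlt_le _ _ hh) (Rlt_le _ _ hf) hQ hV F) as B.
  rewrite hU; unfold utility; cbv zeta in B.
  set (u := Rmin x' Q) in *; set (v := Rmin y' V) in *.
  destruct B as (hu & hv & hux & hvy & hb).
  assert (hd : h * v <= f * v).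
  { destruct hhf as [hhf|hV0]; [apply Rmult_le_compat_r; lra|].
    assert (v = 0) by lra; rewrite H; lra. }
  destruct F as (hx' & hy' & _).
  assert (hfy : 0 <= f * y') by (apply Rmult_le_pos; lra).
  split.
  - apply Rmult_le_reg_l with h; lra.
  - intros E; assert (Ef : h * (u + v) = h * x) by (rewrite E; ring).
    split; [lra|intros _ Ec].
    apply Rmult_le_reg_l with h; lra.
Qed.

(** With a cheaper foreign good the argument is the mirror image, based on
    [(h - f) v <= (h - f) V]. *)
Lemma selected_foreign_first (h f Q V Y : R) :
  0 < f -> f < h -> 0 <= Q -> 0 <= V -> 0 <= Y ->
  let y := Rmin V (Y / f) in
  selected h f Q V Y (Rmin Q ((Y - f * y) / h)) y.
Proof.
  intros hf hfh hQ hV hY y.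
  assert (hw : f * (Y / f) = Y) by (field; lra).
  assert (hw0 : 0 <= Y / f) by (apply Rdiv_le_0_compat; lra).
  assert (hy : 0 <= y <= V /\ f * y <= Y /\ (y = V \/ f * y = Y)).
  { unfold y; destruct (Rmin_cases V (Y / f)) as [[-> H]|[-> H]].
    - apply (Rmult_le_compat_l f) in H; lra.
    - lra. }
  clearbody y; clear hw hw0.
  set (x := Rmin Q ((Y - f * y) / h)).
  assert (hw : h * ((Y - f * y) / h) = Y - f * y) by (field; lra).
  assert (hw0 : 0 <= (Y - f * y) / h) by (apply Rdiv_le_0_compat; lra).
  assert (hx : 0 <= x <= Q /\ h * x <= Y - f * y /\ (x = Q \/ h * x = Y - f * y)).
  { unfold x; destruct (Rmin_cases Q ((Y - f * y) / h)) as [[-> H]|[-> H]].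
    - apply (Rmult_le_compat_l h) in H; lra.
    - lra. }
  clearbody x; clear hw hw0.
  assert (hU : utility Q V x y = x + y)
    by (unfold utility; rewrite !Rmin_left; lra).
  apply selected_intro; [unfold feasible; lra|lra|].
  intros x' y' F.
  assert (hh : 0 <= h) by lra.
  pose proof (served_bounds h f Q V Y x' y' hh (Rlt_le _ _ hf) hQ hV F) as B.
  rewrite hU; unfold utility; cbv zeta in B.
  set (u := Rmin x' Q) in *; set (v := Rmin y' V) in *.
  destruct B as (hu & hv & hux & hvy & hb).
  destruct F as (hx' & hy' & _).
  assert (hdV : (h - f) * v <= (h - f) * V) by (apply Rmult_le_compat_l; lra).
  assert (hfu : f * u <= h * u) by (apply Rmult_le_compat_r; lra).
  destruct hx as (hx0 & hxb & hxc); destruct hy as (hy0 & hyb & hyc).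
  destruct hyc as [hyV|hyY].
  - subst y; destruct hxc as [hxQ|hxY].
    + split; [lra|intros E].
      assert (Eu : u = Q) by lra; assert (Ev : v = V) by lra.
      rewrite Eu in hux; rewrite Ev in hvy; subst x.
      split; [lra|intros h0 Ec].
      apply Rmult_le_reg_l with h; lra.
    + split.
      * apply Rmult_le_reg_l with h; lra.
      * intros E; assert (Eh : h * (u + v) = h * (x + V)) by (rewrite E; ring).
        assert (hvV : V <= v) by (apply Rmult_le_reg_l with (h - f); lra).
        assert (Ev : v = V) by lra; rewrite Ev in *.
        split; [lra|intros h0 Ec].
        apply Rmult_le_reg_l with h; lra.
  - (* the income is exhausted abroad, so nothing is bought at home *)
    assert (Ex : x = 0).
    { apply Rle_antisym; [|lra]; apply Rmult_le_reg_l with h; lra. }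
    subst x; split.
    + apply Rmult_le_reg_l with f; lra.
    + intros E; assert (Ef : f * (u + v) = f * (0 + y)) by (rewrite E; ring).
      split; [lra|intros h0 Ec].
      assert (hu0 : u <= 0) by (apply Rmult_le_reg_l with (h - f); lra).
      apply Rle_trans with u; [|lra].
      apply Rmult_le_reg_l with h; lra.
Qed.

(** * Equilibria at fixed prices *)

Definition positive_data (e : economy) : Prop :=
  0 < q1 e /\ 0 < q2 e /\ 0 < Y1 e /\ 0 < Y2 e /\ 0 < rho e.

(** This region of price space is preserved by every adjustment
    ([adjust_admissible]).  It allows [p2 = 0] and [Y1 = p1 q1], because some
    points of equilibrium lie on that boundary. *)
Definition admissible (e : economy) (p : prices) : Prop :=
  0 < p1 p /\ 0 <= p2 p /\ Y1 e <= p1 p * q1 e /\ p2 p * q2 e <= Y2 e.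

(** The cost for consumer II of the leftover of region I when consumer I spends the
    whole income at home; the lines and zones become comparisons with this number. *)
Definition leftover_cost (e : economy) (p : prices) : R :=
  p1' e p * (q1 e - Y1 e / p1 p).

(** [g] and [k] depend on [p20] only through this number. *)
Definition slack_income (e : economy) (p20 : R) : R := Y2 e - p20 * q2 e.

Lemma leftover_nonneg (e : economy) (p : prices) :
  admissible e p -> 0 <= q1 e - Y1 e / p1 p.
Proof.
  intros (h1 & _ & hY & _).
  assert (p1 p * (Y1 e / p1 p) = Y1 e) by (field; lra).
  assert (Y1 e / p1 p <= q1 e) by (apply Rmult_le_reg_l with (p1 p); lra); lra.
Qed.

(** The suffixes of [NE_home] and [NE_abroad] say where consumer II buys first;
    consumer I spends the whole income at home in both. *)
Definition NE_home (e : economy) (p : prices) : orders :=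
  Orders (Y1 e / p1 p) 0
    (Rmin (q1 e - Y1 e / p1 p) ((Y2 e - p2 p * q2 e) / p1' e p)) (q2 e).

Definition NE_abroad (e : economy) (p : prices) : orders :=
  let c := Rmin (q1 e - Y1 e / p1 p) (Y2 e / p1' e p) in
  Orders (Y1 e / p1 p) 0 c (Rmin (q2 e) ((Y2 e - p1' e p * c) / p2 p)).

(** Consumer II orders all of region II whatever the other does; then nothing is left
    there for consumer I, whose reply no longer depends on which region is cheaper. *)
Lemma NE_home_unique (e : economy) (p : prices) :
  positive_data e -> admissible e p -> p2 p <= p1' e p -> unique (NE e p) (NE_home e p).
Proof.
  intros (hq1 & hq2 & hY1 & hY2 & hr) hp h21.
  pose proof (leftover_nonneg e p hp) as hl.
  destruct hp as (h1 & h2 & hy1 & hy2).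
  assert (h1' : 0 < p1' e p) by (unfold p1'; lra).
  assert (h2' : 0 < p2' e p) by (unfold p2'; lra).
  assert (BII : forall a b, best_reply_II e p a b
     (Rmin (Rmax 0 (q1 e - a)) ((Y2 e - p2 p * q2 e) / p1' e p)) (q2 e)).
  { intros a b; apply best_reply_II_selected, selected_home_saturated;
      try lra; apply Rmax_l. }
  assert (BI : forall c, best_reply_I e p c (q2 e) (Y1 e / p1 p) 0).
  { intros c; apply best_reply_I_selected; rewrite Rmax_left by lra.
    apply selected_home_exhausts_income; lra. }
  split.
  - split; [apply BI|].
    pose proof (BII (Y1 e / p1 p) 0) as B; rewrite Rmax_right in B by exact hl.
    exact B.
  - intros [a b c d] [HI HII]; cbn in HI, HII.
    apply best_reply_II_selected in HII.
    pose proof (BII a b) as B; apply best_reply_II_selected in B.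
    destruct (selected_unique _ _ _ _ _ _ _ _ _ h1' B HII) as [<- <-].
    apply best_reply_I_selected in HI.
    match type of HI with selected _ _ _ _ _ _ _ =>
      pose proof (BI 0) as B'; apply best_reply_I_selected in B' end.
    destruct (selected_unique _ _ _ _ _ _ _ _ _ h2' B' HI) as [<- <-].
    unfold NE_home; rewrite Rmax_right by exact hl; reflexivity.
Qed.

(** Here [p1 < p2 - rho], so home is the cheaper place for consumer I, who spends
    everything there whatever the other does. *)
Lemma NE_abroad_unique (e : economy) (p : prices) :
  positive_data e -> admissible e p -> p1' e p < p2 p -> unique (NE e p) (NE_abroad e p).
Proof.
  intros (hq1 & hq2 & hY1 & hY2 & hr) hp h21.
  pose proof (leftover_nonneg e p hp) as hl.
  destruct hp as (h1 & h2 & hy1 & hy2).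
  assert (h1' : 0 < p1' e p) by (unfold p1'; lra).
  assert (h2' : 0 < p2' e p) by (unfold p2'; lra).
  assert (h12 : p1 p <= p2' e p) by (unfold p1', p2' in *; lra).
  assert (BI : forall c d, best_reply_I e p c d (Y1 e / p1 p) 0).
  { intros c d; apply best_reply_I_selected, selected_home_exhausts_income;
      try lra; apply Rmax_l. }
  assert (BII : best_reply_II e p (Y1 e / p1 p) 0
                  (gamma (NE_abroad e p)) (delta (NE_abroad e p))).
  { apply best_reply_II_selected; rewrite Rmax_right by exact hl.
    apply selected_foreign_first; lra. }
  split.
  - split; [apply BI|exact BII].
  - intros [a b c d] [HI HII]; cbn in HI, HII.
    apply best_reply_I_selected in HI.
    pose proof (BI c d) as B; apply best_reply_I_selected in B.
    destruct (selected_unique _ _ _ _ _ _ _ _ _ h2' B HI) as [<- <-].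
    apply best_reply_II_selected in HII, BII.
    destruct (selected_unique _ _ _ _ _ _ _ _ _ h1' BII HII) as [<- <-].
    reflexivity.
Qed.

Lemma Rle_div_r_iff (x y z : R) : 0 < y -> (x <= z / y <-> y * x <= z).
Proof.
  intros hy; rewrite (Rmult_comm y).
  split; intros H; [apply Rle_div_r in H|apply Rle_div_r]; assumption.
Qed.

Lemma Rdiv_le_l_iff (x y z : R) : 0 < y -> (x / y <= z <-> x <= y * z).
Proof.
  intros hy; rewrite (Rmult_comm y).
  split; intros H; [apply Rle_div_l in H|apply Rle_div_l]; assumption.
Qed.

(** If consumer II can afford both region II and the leftover of region I, then both
    are bought, and it is irrelevant which of them comes first. *)
Lemma NE_a_unique (e : economy) (p : prices) :
  positive_data e -> admissible e p -> p2 p * q2 e <= Y2 e - leftover_cost e p ->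
  unique (NE e p) (NE_a e p).
Proof.
  intros he hp hL.
  pose proof (leftover_nonneg e p hp) as hl.
  pose proof he as (hq1 & hq2 & hY1 & hY2 & hr); pose proof hp as (h1 & h2 & hy1 & hy2).
  assert (h1' : 0 < p1' e p) by (unfold p1'; lra).
  assert (h22 : 0 <= p2 p * q2 e) by (apply Rmult_le_pos; lra).
  unfold leftover_cost in hL.
  destruct (Rle_lt_dec (p2 p) (p1' e p)) as [h|h].
  - replace (NE_a e p) with (NE_home e p); [apply NE_home_unique; auto|].
    unfold NE_home, NE_a; rewrite Rmin_left; [reflexivity|].
    apply Rle_div_r_iff; lra.
  - replace (NE_a e p) with (NE_abroad e p); [apply NE_abroad_unique; auto|].
    unfold NE_abroad, NE_a; rewrite (Rmin_left (q1 e - _)), Rmin_left;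
      [reflexivity| |]; apply Rle_div_r_iff; lra.
Qed.

Lemma NE_II_unique (e : economy) (p : prices) :
  positive_data e -> admissible e p -> p2 p <= p1' e p ->
  Y2 e - p2 p * q2 e <= leftover_cost e p -> unique (NE e p) (NE_II e p).
Proof.
  intros he hp h hL.
  pose proof he as (hq1 & hq2 & hY1 & hY2 & hr); pose proof hp as (h1 & h2 & hy1 & hy2).
  assert (h1' : 0 < p1' e p) by (unfold p1'; lra).
  replace (NE_II e p) with (NE_home e p); [apply NE_home_unique; auto|].
  unfold NE_home, NE_II; rewrite Rmin_right; [reflexivity|].
  apply Rdiv_le_l_iff; [exact h1'|exact hL].
Qed.

Lemma NE_b_I_unique (e : economy) (p : prices) :
  positive_data e -> admissible e p -> p1' e p < p2 p ->
  Y2 e - p2 p * q2 e <= leftover_cost e p <= Y2 e -> unique (NE e p) (NE_b_I e p).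
Proof.
  intros he hp h hL.
  pose proof he as (hq1 & hq2 & hY1 & hY2 & hr); pose proof hp as (h1 & h2 & hy1 & hy2).
  assert (h1' : 0 < p1' e p) by (unfold p1'; lra).
  unfold leftover_cost in hL.
  replace (NE_b_I e p) with (NE_abroad e p); [apply NE_abroad_unique; auto|].
  unfold NE_abroad, NE_b_I; rewrite (Rmin_left (q1 e - _)), Rmin_right;
    [reflexivity|apply Rdiv_le_l_iff; lra|apply Rle_div_r_iff; lra].
Qed.

Lemma NE_c_I_unique (e : economy) (p : prices) :
  positive_data e -> admissible e p -> p1' e p < p2 p ->
  Y2 e <= leftover_cost e p -> unique (NE e p) (NE_c_I e p).
Proof.
  intros he hp h hL.
  pose proof he as (hq1 & hq2 & hY1 & hY2 & hr); pose proof hp as (h1 & h2 & hy1 & hy2).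
  assert (h1' : 0 < p1' e p) by (unfold p1'; lra).
  unfold leftover_cost in hL.
  replace (NE_c_I e p) with (NE_abroad e p); [apply NE_abroad_unique; auto|].
  unfold NE_abroad, NE_c_I; rewrite (Rmin_right (q1 e - _))
    by (apply Rdiv_le_l_iff; lra).
  replace ((Y2 e - p1' e p * (Y2 e / p1' e p)) / p2 p) with 0 by (field; lra).
  rewrite Rmin_right by lra; reflexivity.
Qed.

(** * Lines, zones and points of equilibrium *)

Lemma below_l1_iff (e : economy) (p : prices) :
  positive_data e -> 0 < p1 p ->
  (Y1 e / p1 p + Y2 e / p1' e p < q1 e <-> Y2 e < leftover_cost e p).
Proof.
  intros (_ & _ & _ & _ & hr) h1.
  assert (h1' : 0 < p1' e p) by (unfold p1'; lra).
  unfold leftover_cost.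
  split; intros H.
  - apply (Rmult_lt_compat_l (p1' e p)) in H; [|exact h1'].
    replace (p1' e p * (Y1 e / p1 p + Y2 e / p1' e p))
      with (p1' e p * (Y1 e / p1 p) + Y2 e) in H by (field; lra).
    lra.
  - apply Rmult_lt_reg_l with (p1' e p); [exact h1'|].
    replace (p1' e p * (Y1 e / p1 p + Y2 e / p1' e p))
      with (p1' e p * (Y1 e / p1 p) + Y2 e) by (field; lra).
    lra.
Qed.

Lemma on_l1_iff (e : economy) (p : prices) :
  positive_data e -> 0 < p1 p ->
  (on_l1 e p (Y1 e) (Y2 e) <-> Y2 e = leftover_cost e p).
Proof.
  intros (_ & _ & _ & _ & hr) h1.
  assert (h1' : 0 < p1' e p) by (unfold p1'; lra).
  unfold on_l1, l1_rhs, leftover_cost.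
  split; intros H.
  - rewrite H; field; lra.
  - rewrite H; field; lra.
Qed.

(** The two sides of the fourth line differ exactly as consumer II's income and the
    cost of both goods do. *)
Lemma l4_gap (e : economy) (p : prices) :
  l4_rhs e p (Y1 e) (Y2 e) - l4_lhs e p = Y2 e - leftover_cost e p - p2 p * q2 e.
Proof. unfold l4_rhs, l4_lhs, leftover_cost, Rdiv; ring. Qed.

Lemma below_l4_iff (e : economy) (p : prices) :
  0 < p2 p ->
  (1 / p2 p * (Y2 e - p1' e p * (q1 e - Y1 e / p1 p)) < q2 e <->
   Y2 e - p2 p * q2 e < leftover_cost e p).
Proof.
  intros h2; fold (leftover_cost e p).
  set (z := Y2 e - leftover_cost e p).
  assert (hz : p2 p * (1 / p2 p * z) = z) by (field; lra).
  split; intros H.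
  - apply (Rmult_lt_compat_l (p2 p)) in H; [|exact h2]; unfold z in *; lra.
  - apply Rmult_lt_reg_l with (p2 p); [exact h2|]; unfold z in *; lra.
Qed.

Lemma zone_II_1_iff (e : economy) (p : prices) :
  positive_data e -> 0 < p1 p ->
  (zone_II_1 e p <-> Y1 e < p1 p * q1 e /\ p2 p * q2 e <= Y2 e /\
                     Y2 e < leftover_cost e p).
Proof.
  intros he h1; unfold zone_II_1, Rgt; rewrite below_l1_iff by auto; reflexivity.
Qed.

Lemma zone_II_2_iff (e : economy) (p : prices) :
  positive_data e -> 0 < p1 p -> 0 < p2 p ->
  (zone_II_2 e p <-> Y1 e < p1 p * q1 e /\ p2 p * q2 e <= Y2 e /\
                     slack_income e (p2 p) < leftover_cost e p /\
                     leftover_cost e p <= Y2 e).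
Proof.
  intros he h1 h2; unfold zone_II_2, Rgt; rewrite below_l4_iff by auto.
  pose proof (below_l1_iff e p he h1) as B; unfold slack_income.
  split; intros (H & H' & H4 & H1); repeat split; auto.
  - destruct (Rlt_le_dec (Y2 e) (leftover_cost e p)) as [h|h]; [|exact h].
    apply B in h; lra.
  - destruct (Rlt_le_dec (Y1 e / p1 p + Y2 e / p1' e p) (q1 e)) as [h|h]; [|lra].
    apply B in h; lra.
Qed.

Lemma zone_II_3_iff (e : economy) (p : prices) :
  0 < p2 p ->
  (zone_II_3 e p <-> Y1 e < p1 p * q1 e /\ p2 p * q2 e < Y2 e /\
                     leftover_cost e p <= slack_income e (p2 p)).
Proof.
  intros h2; unfold zone_II_3; pose proof (below_l4_iff e p h2) as B.
  unfold slack_income.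
  split; intros (H & H' & H4); repeat split; auto.
  - destruct (Rlt_le_dec (Y2 e - p2 p * q2 e) (leftover_cost e p)) as [h|h]; [|exact h].
    apply B in h; lra.
  - match goal with |- q2 e <= ?z => destruct (Rlt_le_dec z (q2 e)) as [h|h] end;
      [|exact h].
    apply B in h; lra.
Qed.

Lemma leftover_pos (e : economy) (p : prices) :
  positive_data e -> 0 < p1 p -> Y1 e < p1 p * q1 e -> 0 < leftover_cost e p.
Proof.
  intros (_ & _ & _ & _ & hr) h1 hY.
  assert (p1 p * (Y1 e / p1 p) = Y1 e) by (field; lra).
  assert (Y1 e / p1 p < q1 e) by (apply Rmult_lt_reg_l with (p1 p); lra).
  unfold leftover_cost; apply Rmult_lt_0_compat; unfold p1'; lra.
Qed.

(** The balance equation says that consumer II's income pays exactly for region II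
    and the leftover of region I.  It covers points on the fourth line, points on the
    first line with [p2 = 0], and type E, where the leftover is empty. *)
Lemma pe_of_balance (e : economy) (p : prices) :
  positive_data e -> admissible e p -> p2 p * q2 e = Y2 e - leftover_cost e p -> pe e p.
Proof.
  intros he hp hL.
  exists (NE_a e p); split; [apply NE_a_unique; auto; lra|].
  pose proof hp as (h1 & _).
  unfold leftover_cost in hL; cbn; repeat split; try field; lra.
Qed.

Lemma l4_equilibrium_of_balance (e : economy) (p : prices) :
  positive_data e -> admissible e p -> Y1 e < p1 p * q1 e ->
  p2 p * q2 e = Y2 e - leftover_cost e p -> l4_equilibrium e p.
Proof.
  intros he hp hY hL.
  pose proof hp as (h1 & _).
  pose proof (leftover_pos e p he h1 hY) as hl.
  split; [apply pe_of_balance; auto|split; [exact hY|split; [lra|]]].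
  pose proof (l4_gap e p) as G; unfold on_l4; lra.
Qed.

(** * The downward recursion for the first price *)

Lemma k_pos (e : economy) (p20 : R) : positive_data e -> 0 < k e p20.
Proof.
  intros (hq1 & _ & hY1 & _ & hr).
  unfold k; set (B := rho e * q1 e - Y1 e - Y2 e + p20 * q2 e).
  assert (hc : 0 < 4 * q1 e * rho e * Y1 e) by (repeat apply Rmult_lt_0_compat; lra).
  assert (hs : Rabs B < sqrt (B ^ 2 + 4 * q1 e * rho e * Y1 e)).
  { rewrite <- (sqrt_Rsqr_abs B); apply sqrt_lt_1_alt.
    rewrite Rsqr_pow2; split; [apply pow2_ge_0|lra]. }
  apply Rmult_lt_0_compat; [apply Rdiv_lt_0_compat; lra|].
  pose proof (Rle_abs B); lra.
Qed.

Lemma k_quadratic (e : economy) (p20 : R) : positive_data e ->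
  q1 e * k e p20 ^ 2
  + (rho e * q1 e - Y1 e - slack_income e p20) * k e p20 - rho e * Y1 e = 0.
Proof.
  intros (hq1 & _ & hY1 & _ & hr).
  unfold k, slack_income; set (B := rho e * q1 e - Y1 e - Y2 e + p20 * q2 e).
  assert (hc : 0 < 4 * q1 e * rho e * Y1 e) by (repeat apply Rmult_lt_0_compat; lra).
  assert (hs : sqrt (B ^ 2 + 4 * q1 e * rho e * Y1 e) ^ 2
               = B ^ 2 + 4 * q1 e * rho e * Y1 e).
  { apply pow2_sqrt; pose proof (pow2_ge_0 B); lra. }
  set (r := sqrt _) in *.
  replace (rho e * q1 e - Y1 e - (Y2 e - p20 * q2 e)) with B by (unfold B; ring).
  replace (q1 e * (1 / (2 * q1 e) * (r - B)) ^ 2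
           + B * (1 / (2 * q1 e) * (r - B)) - rho e * Y1 e)
    with ((r ^ 2 - B ^ 2) / (4 * q1 e) - rho e * Y1 e) by (field; lra).
  rewrite hs; field; lra.
Qed.

(** This is the fixed point equation of [g] multiplied by [q1], the form in which it
    is used in comparisons. *)
Lemma k_balance (e : economy) (p20 : R) : positive_data e ->
  q1 e * k e p20 = Y1 e + slack_income e p20 * (k e p20 / (k e p20 + rho e)).
Proof.
  intros he; pose proof (k_pos e p20 he) as hk; pose proof (k_quadratic e p20 he) as Q.
  destruct he as (hq1 & _ & _ & _ & hr).
  apply Rmult_eq_reg_r with (k e p20 + rho e); [|lra].
  replace ((Y1 e + slack_income e p20 * (k e p20 / (k e p20 + rho e)))
            * (k e p20 + rho e))
    with (Y1 e * (k e p20 + rho e) + slack_income e p20 * k e p20) by (field; lra).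
  lra.
Qed.

(** Contraction rate of [g] towards [k]; it bounds the difference quotient of [g]
    between [k] and any positive price. *)
Definition rate (e : economy) (p20 : R) : R :=
  slack_income e p20 / (q1 e * (k e p20 + rho e)).

(** The fixed point equation reads [rate * k = k - Y1 / q1], so the rate is smaller
    than one because [Y1] is positive. *)
Lemma rate_bounds (e : economy) (p20 : R) :
  positive_data e -> 0 <= slack_income e p20 -> 0 <= rate e p20 < 1.
Proof.
  intros he hD; pose proof (k_pos e p20 he) as hk.
  pose proof (k_balance e p20 he) as B.
  destruct he as (hq1 & _ & hY1 & _ & hr).
  assert (hq : 0 < q1 e * (k e p20 + rho e)) by (apply Rmult_lt_0_compat; lra).
  unfold rate; split; [apply Rdiv_le_0_compat; lra|].
  apply Rlt_div_l; [exact hq|].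
  apply Rmult_lt_reg_r with (k e p20 / (k e p20 + rho e));
    [apply Rdiv_lt_0_compat; lra|].
  replace (1 * (q1 e * (k e p20 + rho e)) * (k e p20 / (k e p20 + rho e)))
    with (q1 e * k e p20) by (field; lra).
  lra.
Qed.

(** Subtracting the fixed point equation, the difference of [x / (x + rho)] and
    [k / (k + rho)] is [rho (x - k) / ((x + rho) (k + rho))]. *)
Lemma g_gap (e : economy) (p20 x : R) : positive_data e -> 0 < x ->
  g e p20 x - k e p20 = rate e p20 * (rho e / (x + rho e)) * (x - k e p20).
Proof.
  intros he hx; pose proof (k_pos e p20 he) as hk.
  pose proof (k_balance e p20 he) as B.
  destruct he as (hq1 & _ & hY1 & _ & hr).
  apply Rmult_eq_reg_l with (q1 e); [|lra].
  rewrite Rmult_minus_distr_l, B; unfold g, rate; fold (slack_income e p20).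
  field; lra.
Qed.

Lemma factor_bounds (e : economy) (p20 x : R) :
  positive_data e -> 0 <= slack_income e p20 -> 0 < x ->
  0 <= rate e p20 * (rho e / (x + rho e)) <= rate e p20.
Proof.
  intros he hD hx.
  pose proof (rate_bounds e p20 he hD) as [hr0 _].
  destruct he as (_ & _ & _ & _ & hr).
  assert (hf : 0 <= rho e / (x + rho e) <= 1).
  { split; [apply Rdiv_le_0_compat; lra|apply Rdiv_le_l_iff; lra]. }
  split; [apply Rmult_le_pos; lra|].
  rewrite <- (Rmult_1_r (rate e p20)) at 2; apply Rmult_le_compat_l; lra.
Qed.

Lemma g_above_k (e : economy) (p20 x : R) :
  positive_data e -> 0 < slack_income e p20 -> k e p20 < x -> k e p20 < g e p20 x.
Proof.
  intros he hD hx; pose proof (k_pos e p20 he) as hk.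
  pose proof he as (hq1 & _ & _ & _ & hr).
  assert (hg : 0 < g e p20 x - k e p20); [|lra].
  rewrite g_gap by (auto; lra).
  apply Rmult_lt_0_compat; [apply Rmult_lt_0_compat|lra];
    apply Rdiv_lt_0_compat; try apply Rmult_lt_0_compat; lra.
Qed.

Lemma g_decreases_iff (e : economy) (p20 x : R) :
  positive_data e -> 0 <= slack_income e p20 -> 0 < x ->
  (g e p20 x < x <-> k e p20 < x).
Proof.
  intros he hD hx.
  pose proof (k_pos e p20 he) as hk; pose proof (rate_bounds e p20 he hD) as hr.
  pose proof (g_gap e p20 x he hx) as G.
  pose proof (factor_bounds e p20 x he hD hx) as hc.
  set (c := rate e p20 * (rho e / (x + rho e))) in *; clearbody c.
  split; intros H.
  - destruct (Rle_lt_dec x (k e p20)) as [h|h]; [exfalso|exact h].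
    assert (c * (k e p20 - x) <= 1 * (k e p20 - x)) by (apply Rmult_le_compat_r; lra).
    lra.
  - assert (c * (x - k e p20) < 1 * (x - k e p20)) by (apply Rmult_lt_compat_r; lra).
    lra.
Qed.

Lemma descent_limit (e : economy) (p20 : R) (u : nat -> R) :
  positive_data e -> 0 < slack_income e p20 ->
  (forall t, k e p20 < u t) -> (forall t, u (S t) = g e p20 (u t)) ->
  is_lim_seq u (k e p20).
Proof.
  intros he hD hk hu.
  pose proof (rate_bounds e p20 he (Rlt_le _ _ hD)) as hr.
  set (c := rate e p20) in *.
  assert (hgeo : forall t, u t - k e p20 <= c ^ t * (u 0%nat - k e p20)).
  { induction t as [|t IH]; [simpl; lra|].
    rewrite hu.
    assert (ht : 0 < u t) by (pose proof (k_pos e p20 he); specialize (hk t); lra).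
    rewrite (g_gap e p20 (u t) he ht).
    pose proof (factor_bounds e p20 (u t) he (Rlt_le _ _ hD) ht) as hf; fold c in hf |- *.
    rewrite <- tech_pow_Rmult, (Rmult_assoc c (c ^ t)).
    apply Rmult_le_compat; specialize (hk t); lra. }
  apply is_lim_seq_le_le with (u := fun _ => k e p20)
    (w := fun t => k e p20 + c ^ t * (u 0%nat - k e p20)).
  - intros t; specialize (hk t); specialize (hgeo t); lra.
  - apply is_lim_seq_const.
  - replace (Finite (k e p20))
      with (Finite (k e p20 + 0 * (u 0%nat - k e p20))) by (f_equal; ring).
    apply is_lim_seq_plus'; [apply is_lim_seq_const|].
    apply is_lim_seq_mult'; [|apply is_lim_seq_const].
    apply is_lim_seq_geom; rewrite Rabs_pos_eq; lra.
Qed.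

Lemma iter_decreases (e : economy) (p20 x : R) :
  positive_data e -> 0 < slack_income e p20 -> k e p20 < x ->
  (forall n, k e p20 < Nat.iter n (g e p20) x) /\
  (forall m n, (m <= n)%nat -> Nat.iter n (g e p20) x <= Nat.iter m (g e p20) x).
Proof.
  intros he hD hx; pose proof (k_pos e p20 he) as hk0.
  assert (hk : forall n, k e p20 < Nat.iter n (g e p20) x).
  { induction n as [|n IH]; [exact hx|cbn; apply g_above_k; auto]. }
  split; [exact hk|].
  intros m n; induction 1 as [|n _ IH]; [lra|].
  specialize (hk n).
  apply Rle_trans with (2 := IH), Rlt_le; cbn; apply g_decreases_iff; auto; lra.
Qed.

(** A sequence that starts at or above [m] and is somewhere below it has a step that
    crosses [m]. *)
Lemma first_crossing (u : nat -> R) (m : R) (n : nat) :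
  m <= u 0%nat -> u n < m -> exists s, u (S s) < m <= u s.
Proof.
  intros h0; induction n as [|n IH]; intros hn; [lra|].
  destruct (Rlt_le_dec (u n) m) as [h|h]; [auto|exists n; auto].
Qed.

Lemma g_crossing (e : economy) (p20 x m : R) :
  positive_data e -> 0 < slack_income e p20 -> k e p20 < m -> m <= x ->
  exists s, Nat.iter (S s) (g e p20) x < m <= Nat.iter s (g e p20) x.
Proof.
  intros he hD hm hx.
  destruct (iter_decreases e p20 x he hD) as [hk _]; [lra|].
  pose proof (descent_limit e p20 (fun n => Nat.iter n (g e p20) x) he hD hk
                (fun _ => eq_refl)) as L.
  apply is_lim_seq_spec in L.
  assert (hpos : 0 < m - k e p20) by lra.
  destruct (L (mkposreal _ hpos)) as [N HN]; specialize (HN N (le_n N)); cbn in HN.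
  apply Rabs_lt_between in HN.
  apply first_crossing with N; cbn; lra.
Qed.

(** With a free good in region II consumer II's whole income is available for
    region I, which is [k] with slack income [Y2]. *)
Lemma p1_inf_k (e : economy) : p1_inf e = k e 0.
Proof.
  unfold p1_inf, k; f_equal.
  replace ((rho e * q1 e - Y1 e - Y2 e + 0 * q2 e) ^ 2 + 4 * q1 e * rho e * Y1 e)
    with ((Y1 e + Y2 e - rho e * q1 e) ^ 2 + 4 * rho e * q1 e * Y1 e) by ring.
  ring.
Qed.

(** The price [p20] that defines the slack income need not be the second coordinate
    of [p]: at the start of the descent to [p1_inf] the second price is positive while
    [p1] already moves as if it were zero. *)
Lemma g_decreases_leftover (e : economy) (p20 : R) (p : prices) :
  positive_data e -> 0 < p1 p ->
  (g e p20 (p1 p) < p1 p <-> slack_income e p20 < leftover_cost e p).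
Proof.
  intros (hq1 & _ & _ & _ & hr) h1.
  assert (h1' : 0 < p1' e p) by (unfold p1'; lra).
  assert (E : p1 p - g e p20 (p1 p)
              = p1 p / (q1 e * p1' e p) * (leftover_cost e p - slack_income e p20)).
  { unfold g, leftover_cost, slack_income, p1' in *; field; lra. }
  assert (hc : 0 < p1 p / (q1 e * p1' e p))
    by (apply Rdiv_lt_0_compat; [|apply Rmult_lt_0_compat]; lra).
  split; intros H.
  - destruct (Rlt_le_dec (slack_income e p20) (leftover_cost e p)) as [h|h]; [exact h|].
    assert (p1 p / (q1 e * p1' e p) * (leftover_cost e p - slack_income e p20)
            <= p1 p / (q1 e * p1' e p) * 0) by (apply Rmult_le_compat_l; lra).
    lra.
  - assert (0 < p1 p / (q1 e * p1' e p) * (leftover_cost e p - slack_income e p20))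
      by (apply Rmult_lt_0_compat; lra).
    lra.
Qed.

Lemma k_below_iff (e : economy) (p20 : R) (p : prices) :
  positive_data e -> 0 <= slack_income e p20 -> 0 < p1 p ->
  (k e p20 < p1 p <-> slack_income e p20 < leftover_cost e p).
Proof.
  intros he hD h1.
  rewrite <- (g_decreases_iff e p20 (p1 p)) by auto.
  apply g_decreases_leftover; auto.
Qed.

(** Even at the price [k] region I is worth at least [Y1]. *)
Lemma k_income (e : economy) (p20 x : R) :
  positive_data e -> 0 <= slack_income e p20 -> k e p20 < x -> Y1 e < x * q1 e.
Proof.
  intros he hD hx; pose proof (k_pos e p20 he) as hk; pose proof (k_balance e p20 he) as B.
  destruct he as (hq1 & _ & _ & _ & hr).
  assert (0 <= slack_income e p20 * (k e p20 / (k e p20 + rho e)))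
    by (apply Rmult_le_pos; [|apply Rdiv_le_0_compat]; lra).
  assert (q1 e * k e p20 < q1 e * x) by (apply Rmult_lt_compat_l; lra).
  lra.
Qed.

(** As [p1] falls consumer I buys more and the unit price paid by consumer II falls:
    a descent cannot leave the region on or above the first line. *)
Lemma leftover_increasing (e : economy) (p p' : prices) :
  positive_data e -> 0 < p1 p -> p1 p <= p1 p' -> Y1 e <= p1 p * q1 e ->
  leftover_cost e p <= leftover_cost e p'.
Proof.
  intros (hq1 & _ & hY1 & _ & hr) h1 hpp hY.
  assert (p1 p * (Y1 e / p1 p) = Y1 e) by (field; lra).
  assert (Y1 e / p1 p <= q1 e) by (apply Rmult_le_reg_l with (p1 p); lra).
  assert (Y1 e / p1 p' <= Y1 e / p1 p)
    by (apply Rmult_le_compat_l; [lra|apply Rinv_le_contravar; lra]).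
  unfold leftover_cost, p1'; apply Rmult_le_compat; lra.
Qed.

(** * Price adjustment *)

Lemma next_price_down (pr q qcons Yres : R) :
  qcons < q -> next_price pr q qcons Yres = pr * qcons / q.
Proof. intros H; unfold next_price; destruct (Rlt_dec qcons q); [reflexivity|lra]. Qed.

Lemma next_price_up (pr q qcons Yres : R) :
  q <= qcons -> pr * q < Yres -> next_price pr q qcons Yres = Yres / q.
Proof.
  intros H H'; unfold next_price; destruct (Rlt_dec qcons q); [lra|].
  destruct (Rlt_dec (pr * q) Yres); [reflexivity|lra].
Qed.

Lemma next_price_stay (pr q qcons Yres : R) :
  q <= qcons -> Yres <= pr * q -> next_price pr q qcons Yres = pr.
Proof.
  intros H H'; unfold next_price; destruct (Rlt_dec qcons q); [lra|].
  destruct (Rlt_dec (pr * q) Yres); [lra|reflexivity].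
Qed.

Lemma process_step (e : economy) (P : nat -> prices) (t : nat) (x : orders) :
  price_process e P -> unique (NE e (P t)) x -> P (S t) = adjust e (P t) x.
Proof.
  intros HP [_ U]; destruct (HP t) as (y & Hy & ->).
  rewrite (U y Hy); reflexivity.
Qed.

Lemma process_shift (e : economy) (P : nat -> prices) (s : nat) :
  price_process e P -> price_process e (shift s P).
Proof.
  intros HP t; unfold shift; rewrite Nat.add_succ_r; apply HP.
Qed.

(** A choice of equilibrium at every admissible price, used to build a process. *)
Definition the_NE (e : economy) (p : prices) : orders :=
  if Rle_dec (p2 p) (p1' e p) then NE_home e p else NE_abroad e p.

Lemma the_NE_unique (e : economy) (p : prices) :
  positive_data e -> admissible e p -> unique (NE e p) (the_NE e p).
Proof.
  intros he hp; unfold the_NE; destruct (Rle_dec _ _).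
  - apply NE_home_unique; auto.
  - apply NE_abroad_unique; auto; lra.
Qed.

Lemma the_NE_shape (e : economy) (p : prices) :
  positive_data e -> admissible e p ->
  let x := the_NE e p in
  alpha x = Y1 e / p1 p /\ beta x = 0 /\
  0 <= gamma x <= q1 e - Y1 e / p1 p /\ 0 <= delta x <= q2 e.
Proof.
  intros he hp x.
  pose proof (leftover_nonneg e p hp) as hl.
  destruct he as (hq1 & hq2 & hY1 & hY2 & hr), hp as (h1 & h2 & hy1 & hy2).
  assert (h1' : 0 < p1' e p) by (unfold p1'; lra).
  unfold x, the_NE; destruct (Rle_dec (p2 p) (p1' e p)) as [h|h]; cbn;
    repeat apply conj; try reflexivity; try apply Rmin_l; try lra.
  - apply Rmin_glb; [lra|apply Rdiv_le_0_compat; lra].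
  - apply Rmin_glb; [lra|apply Rdiv_le_0_compat; lra].
  - apply Rmin_glb; [lra|apply Rdiv_le_0_compat; [|lra]].
    pose proof (Rmin_r (q1 e - Y1 e / p1 p) (Y2 e / p1' e p)) as M.
    apply (Rmult_le_compat_l (p1' e p)) in M; [|lra].
    replace (p1' e p * (Y2 e / p1' e p)) with (Y2 e) in M by (field; lra); lra.
Qed.

(** A price falls only in proportion to sales, and sales in region I include
    [Y1 / p1], so the supply of region I stays worth at least [Y1]; the second price
    is never raised beyond what consumer II can pay. *)
Lemma adjust_admissible (e : economy) (p : prices) :
  positive_data e -> admissible e p -> admissible e (adjust e p (the_NE e p)).
Proof.
  intros he hp.
  destruct (the_NE_shape e p he hp) as (ha & hb & hc & hd).
  destruct he as (hq1 & hq2 & hY1 & hY2 & hr), hp as (h1 & h2 & hy1 & hy2).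
  assert (h1' : 0 < p1' e p) by (unfold p1'; lra).
  assert (hpY : p1 p * (Y1 e / p1 p) = Y1 e) by (field; lra).
  set (x := the_NE e p) in *; clearbody x.
  assert (H1 : Y1 e <= p1 (adjust e p x) * q1 e).
  { cbn; unfold next_price, q1cons, Y1res; rewrite ha, hb.
    destruct (Rlt_dec _ _) as [_|_].
    - assert (0 <= p1 p * gamma x) by (apply Rmult_le_pos; lra).
      replace (p1 p * (Y1 e / p1 p + gamma x) / q1 e * q1 e)
        with (p1 p * (Y1 e / p1 p) + p1 p * gamma x) by (field; lra).
      lra.
    - destruct (Rlt_dec _ _) as [_|_]; [|exact hy1].
      apply Req_le; field; lra. }
  assert (H2 : 0 <= p2 (adjust e p x) * q2 e <= Y2 e).
  { assert (h22 : 0 <= p2 p * q2 e) by (apply Rmult_le_pos; lra).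
    cbn; unfold next_price, q2cons, Y2res; rewrite hb, Rplus_0_l.
    destruct (Rlt_dec _ _) as [_|_].
    - replace (p2 p * delta x / q2 e * q2 e) with (p2 p * delta x) by (field; lra).
      assert (p2 p * delta x <= p2 p * q2 e) by (apply Rmult_le_compat_l; lra).
      split; [apply Rmult_le_pos; lra|lra].
    - destruct (Rlt_dec _ _) as [hup|_]; [|lra].
      assert (0 <= p1' e p * gamma x) by (apply Rmult_le_pos; lra).
      replace ((Y2 e - p1' e p * gamma x) / q2 e * q2 e)
        with (Y2 e - p1' e p * gamma x) by (field; lra).
      lra. }
  split; [|split; [|split; [exact H1|apply H2]]].
  - apply Rmult_lt_reg_r with (q1 e); lra.
  - apply Rmult_le_reg_r with (q2 e); lra.
Qed.

Lemma process_exists (e : economy) (p0 : prices) :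
  positive_data e -> admissible e p0 -> exists P, price_process e P /\ P 0%nat = p0.
Proof.
  intros he hp.
  exists (fun t => Nat.iter t (fun p => adjust e p (the_NE e p)) p0).
  split; [|reflexivity]; intros t.
  set (p := Nat.iter t _ p0).
  assert (hpt : admissible e p).
  { unfold p; clear p; induction t as [|t IH]; [exact hp|cbn; apply adjust_admissible; auto]. }
  exists (the_NE e p); split; [apply the_NE_unique; auto|reflexivity].
Qed.

(** * Adjustment patterns *)

(** The basic step of the descents: region II is cleared exactly and
    consumer II has nothing left, so only the first price moves, by [g]. *)
Lemma step_II (e : economy) (P : nat -> prices) (t : nat) :
  positive_data e -> price_process e P ->
  0 <= p2 (P t) -> p2 (P t) <= p1' e (P t) -> 0 <= slack_income e (p2 (P t)) ->
  k e (p2 (P t)) < p1 (P t) ->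
  down1 e P t /\ p1 (P (S t)) = g e (p2 (P t)) (p1 (P t)) /\ p2 (P (S t)) = p2 (P t).
Proof.
  intros he HP h2 h21 hD hk.
  set (p := P t) in *.
  pose proof (k_pos e (p2 p) he) as hk0.
  pose proof (k_income e (p2 p) (p1 p) he hD hk) as hY.
  assert (h1 : 0 < p1 p) by lra.
  assert (hp : admissible e p) by (unfold slack_income in hD; repeat split; lra).
  apply (k_below_iff e (p2 p) p he hD h1) in hk.
  assert (U : unique (NE e p) (NE_II e p)).
  { apply NE_II_unique; auto; apply Rlt_le, hk. }
  pose proof (process_step e P t _ HP U) as ST; fold p in ST.
  pose proof he as (hq1 & hq2 & hY1 & hY2 & hr).
  assert (h1' : 0 < p1' e p) by (unfold p1'; lra).
  assert (hc : q1cons (NE_II e p) < q1 e).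
  { unfold q1cons; cbn; fold (slack_income e (p2 p)).
    enough (slack_income e (p2 p) / p1' e p < q1 e - Y1 e / p1 p) by lra.
    apply Rlt_div_l; [exact h1'|]; unfold leftover_cost in hk; lra. }
  assert (E1 : p1 (P (S t)) = p1 p * q1cons (NE_II e p) / q1 e).
  { rewrite ST; cbn; apply next_price_down, hc. }
  split; [|split].
  - exists (NE_II e p); split; [apply U|auto].
  - rewrite E1; unfold q1cons, g, p1' in *; cbn; unfold p1'; field; lra.
  - rewrite ST; cbn; apply next_price_stay.
    + unfold q2cons; cbn; lra.
    + unfold Y2res; cbn; apply Req_le; field; lra.
Qed.

(** Region I is cleared, and the reduced second price makes the value of region II
    equal to what consumer II spends there, which is the balance equation.  On the
    first line nothing is spent there and the new price is zero. *)
Lemma pattern_b_I_holds (e : economy) (P : nat -> prices) :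
  positive_data e -> price_process e P -> admissible e (P 0%nat) ->
  Y1 e < p1 (P 0%nat) * q1 e -> p1' e (P 0%nat) < p2 (P 0%nat) ->
  slack_income e (p2 (P 0%nat)) < leftover_cost e (P 0%nat) <= Y2 e ->
  pattern_b_I e P.
Proof.
  intros he HP hp hY h12 hL; unfold slack_income in hL.
  set (p := P 0%nat) in *.
  assert (U : unique (NE e p) (NE_b_I e p)) by (apply NE_b_I_unique; auto; lra).
  pose proof (process_step e P 0 _ HP U) as ST; fold p in ST.
  pose proof he as (hq1 & hq2 & hY1 & hY2 & hr).
  pose proof hp as (h1 & h2 & hy1 & hy2).
  assert (hp2 : 0 < p2 p) by (unfold p1' in h12; lra).
  set (d := (Y2 e - leftover_cost e p) / p2 p).
  assert (Ed : q2cons (NE_b_I e p) = d) by (unfold q2cons; cbn; apply Rplus_0_l).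
  assert (hd : d < q2 e) by (apply Rlt_div_l; lra).
  assert (E2 : p2 (P 1%nat) = p2 p * q2cons (NE_b_I e p) / q2 e).
  { rewrite ST; cbn; apply next_price_down; rewrite Ed; exact hd. }
  assert (E1 : p1 (P 1%nat) = p1 p).
  { rewrite ST; cbn; apply next_price_stay.
    - unfold q1cons; cbn; lra.
    - unfold Y1res; cbn; lra. }
  assert (B : p2 (P 1%nat) * q2 e = Y2 e - leftover_cost e p).
  { rewrite E2, Ed; unfold d; field; lra. }
  assert (EL : leftover_cost e (P 1%nat) = leftover_cost e p)
    by (unfold leftover_cost, p1'; rewrite E1; reflexivity).
  assert (hl : 0 < leftover_cost e p) by (apply leftover_pos; auto).
  assert (hp' : admissible e (P 1%nat)).
  { split; [lra|split; [|split; [rewrite E1; exact hy1|lra]]].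
    apply Rmult_le_reg_r with (q2 e); lra. }
  assert (D : down2 e P 0).
  { exists (NE_b_I e p); split; [apply U|split; [rewrite Ed; exact hd|exact E2]]. }
  split; intros Hl1; (split; [exact D|split; [exact E1|]]).
  - apply l4_equilibrium_of_balance; auto; [rewrite E1; exact hY|lra].
  - apply on_l1_iff in Hl1; auto.
    assert (Z : p2 (P 1%nat) = 0) by (apply Rmult_eq_reg_r with (q2 e); fold p in Hl1; lra).
    split; [exact Z|].
    split; [apply pe_of_balance; auto; lra|].
    split; [lra|split; [exact Z|]].
    apply on_l1_iff; auto; [lra|]; rewrite EL; exact Hl1.
Qed.

(** Nothing is bought in region II, so its price drops to zero at once; from then on
    consumer II gets region II for free and the whole income [Y2] goes to region I.
    The first price follows [g] at [p20 = 0] from the very beginning. *)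
Lemma pattern_c_I_holds (e : economy) (P : nat -> prices) :
  positive_data e -> price_process e P -> admissible e (P 0%nat) ->
  p1' e (P 0%nat) < p2 (P 0%nat) -> Y2 e < leftover_cost e (P 0%nat) ->
  pattern_c_I e P.
Proof.
  intros he HP hp h12 hL.
  pose proof he as (hq1 & hq2 & hY1 & hY2 & hr).
  pose proof hp as (h1 & h2 & hy1 & hy2).
  assert (ES : slack_income e 0 = Y2 e) by (unfold slack_income; ring).
  assert (hD : 0 < slack_income e 0) by lra.
  pose proof (k_pos e 0 he) as hk0.
  assert (H0 : k e 0 < p1 (P 0%nat)) by (apply k_below_iff; auto; lra).
  assert (S0 : down1 e P 0 /\ p1 (P 1%nat) = g e 0 (p1 (P 0%nat)) /\ p2 (P 1%nat) = 0).
  { set (p := P 0%nat) in *.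
    assert (U : unique (NE e p) (NE_c_I e p)) by (apply NE_c_I_unique; auto; lra).
    pose proof (process_step e P 0 _ HP U) as ST; fold p in ST.
    assert (hc : q1cons (NE_c_I e p) < q1 e) by (apply below_l1_iff; auto).
    assert (E1 : p1 (P 1%nat) = p1 p * q1cons (NE_c_I e p) / q1 e)
      by (rewrite ST; cbn; apply next_price_down, hc).
    split; [exists (NE_c_I e p); split; [apply U|auto]|split].
    - rewrite E1; unfold q1cons, g; cbn; unfold p1'; field; lra.
    - rewrite ST; cbn; rewrite next_price_down; unfold q2cons; cbn; [field|]; lra. }
  assert (ST : forall t, k e 0 < p1 (P t) -> p2 (P t) = 0 ->
     down1 e P t /\ p1 (P (S t)) = g e 0 (p1 (P t)) /\ p2 (P (S t)) = 0).
  { intros t hk Z; rewrite <- Z at 1 2.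
    apply step_II; auto; rewrite Z; try lra; unfold p1'; lra. }
  assert (INV : forall t, k e 0 < p1 (P t) /\ ((1 <= t)%nat -> p2 (P t) = 0)).
  { induction t as [|t [IH1 IH2]]; [split; [exact H0|lia]|].
    assert (E : p1 (P (S t)) = g e 0 (p1 (P t)) /\ p2 (P (S t)) = 0).
    { destruct t as [|t]; [apply S0|apply ST; auto; apply IH2; lia]. }
    destruct E as [E1 E2]; rewrite E1; split; [apply g_above_k; auto|auto]. }
  assert (ALL : forall t, down1 e P t /\ p1 (P (S t)) = g e 0 (p1 (P t))).
  { intros t; destruct (INV t) as [hk Z].
    destruct t as [|t]; [split; apply S0|].
    destruct (ST (S t) hk) as (D & E & _); [apply Z; lia|auto]. }
  assert (DEC : forall t, p1 (P (S t)) < p1 (P t)).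
  { intros t; destruct (INV t) as [hk _]; rewrite (proj2 (ALL t)).
    apply g_decreases_iff; auto; lra. }
  assert (LIM : is_lim_seq (fun t => p1 (P t)) (k e 0)).
  { apply descent_limit; auto; intros t; [apply INV|apply ALL]. }
  unfold pattern_c_I; rewrite p1_inf_k.
  split; [intros t; apply ALL|split; [exact DEC|split; [exact LIM|split; [apply INV|split]]]].
  - split; [|split; [exact LIM|split]].
    + intros t E; specialize (DEC t); rewrite E in DEC; lra.
    + apply is_lim_seq_ext_loc with (fun _ => 0); [|apply is_lim_seq_const].
      exists 1%nat; intros t Ht; symmetry; apply INV, Ht.
    + pose proof (k_balance e 0 he) as B; rewrite ES in B.
      apply on_l1_iff; auto; unfold leftover_cost, p1'; cbn.
      apply Rmult_eq_reg_l with (k e 0 / (k e 0 + rho e));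
        [|apply Rgt_not_eq, Rdiv_lt_0_compat; lra].
      replace (k e 0 / (k e 0 + rho e) * ((k e 0 + rho e) * (q1 e - Y1 e / k e 0)))
        with (q1 e * k e 0 - Y1 e) by (field; lra).
      lra.
  - intros y1 y2; unfold on_l1, l1_rhs, p1'; cbn; split; intros; symmetry; assumption.
Qed.

(** The last hypothesis isolates what depends on the zone: how a process behaves once
    the first price has dropped more than [rho] below the second, still above [k]. *)
Lemma pattern_II_holds (case_I : economy -> (nat -> prices) -> Prop)
    (e : economy) (P : nat -> prices) :
  positive_data e -> price_process e P ->
  0 < p2 (P 0%nat) -> p2 (P 0%nat) <= p1' e (P 0%nat) ->
  0 <= slack_income e (p2 (P 0%nat)) -> k e (p2 (P 0%nat)) < p1 (P 0%nat) ->
  (forall Q, price_process e Q -> p2 (Q 0%nat) = p2 (P 0%nat) ->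
     k e (p2 (Q 0%nat)) < p1 (Q 0%nat) -> p1 (Q 0%nat) <= p1 (P 0%nat) ->
     p1 (Q 0%nat) - p2 (Q 0%nat) < - rho e -> case_I e Q) ->
  pattern_II case_I e P.
Proof.
  intros he HP h2 h21 hD0 hk0 HI; unfold pattern_II; cbv zeta.
  set (x := p1 (P 0%nat)) in *; set (c := p2 (P 0%nat)) in *.
  pose proof he as (hq1 & hq2 & hY1 & hY2 & hr).
  pose proof (k_pos e c he) as kpos.
  assert (STEP : forall t, p2 (P t) = c -> k e c < p1 (P t) -> c - rho e <= p1 (P t) ->
     down1 e P t /\ p1 (P (S t)) = g e c (p1 (P t)) /\ p2 (P (S t)) = c).
  { intros t Z hk hc; rewrite <- Z at 1 2.
    apply step_II; auto; rewrite Z; try lra; unfold p1'; lra. }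
  split.
  - intros E.
    assert (hc : c - rho e <= x) by (unfold p1' in h21; fold x in h21; lra).
    destruct (STEP 0%nat eq_refl hk0 hc) as (D & E1 & E2); fold x in E1.
    assert (E1' : p1 (P 1%nat) = Y1 e / q1 e).
    { rewrite E1; unfold g; replace (Y2 e - c * q2 e) with 0 by lra; field; lra. }
    assert (EL : leftover_cost e (P 1%nat) = 0)
      by (unfold leftover_cost; rewrite E1'; field; lra).
    assert (hp : admissible e (P 1%nat)).
    { unfold admissible; rewrite E1', E2; repeat split; try lra.
      - apply Rdiv_lt_0_compat; lra.
      - apply Req_le; field; lra. }
    assert (B : p2 (P 1%nat) * q2 e = Y2 e - leftover_cost e (P 1%nat))
      by (rewrite E2, EL; lra).
    split; [exact D|split; [exact E2|]].
    split; [apply pe_of_balance; auto|split; [exact E1'|split]].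
    + rewrite E2, E; field; lra.
    + replace (Orders (q1 e) 0 0 (q2 e)) with (NE_a e (P 1%nat));
        [apply NE_a_unique; auto; lra|].
      unfold NE_a; rewrite E1'; f_equal; field; lra.
  - intros hYs.
    assert (hD : 0 < slack_income e c) by (unfold slack_income; lra).
    split.
    + intros [hck _].
      assert (INV : forall t, p2 (P t) = c /\ k e c < p1 (P t)).
      { induction t as [|t [IH1 IH2]]; [split; [reflexivity|exact hk0]|].
        destruct (STEP t IH1 IH2) as (_ & -> & ->); [lra|].
        split; [reflexivity|apply g_above_k; auto]. }
      assert (ALL : forall t, down1 e P t /\ p1 (P (S t)) = g e c (p1 (P t))
                              /\ p2 (P (S t)) = c).
      { intros t; destruct (INV t); apply STEP; auto; lra. }
      assert (LIM : is_lim_seq (fun t => p1 (P t)) (k e c)).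
      { apply descent_limit; auto; intros t; [apply INV|apply ALL]. }
      split; [|split; [exact LIM|split]].
      * intros t; split; [apply ALL|rewrite (proj1 (INV t)); apply ALL].
      * split; [|split; [exact LIM|split]].
        -- intros t E; destruct (INV t) as [_ hk].
           assert (g e c (p1 (P t)) < p1 (P t)) by (apply g_decreases_iff; auto; lra).
           rewrite <- (proj1 (proj2 (ALL t))), E in H; lra.
        -- apply is_lim_seq_ext with (fun _ => c); [|apply is_lim_seq_const].
           intros t; symmetry; apply INV.
        -- pose proof (k_balance e c he) as B; unfold slack_income in B.
           unfold on_l4, l4_lhs, l4_rhs, p1'; cbn.
           apply Rmult_eq_reg_l with (k e c / (k e c + rho e));
             [|apply Rgt_not_eq, Rdiv_lt_0_compat; lra].
           transitivity (q1 e * k e c + c * q2 e * (k e c / (k e c + rho e)));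
             [field; lra|rewrite B; field; lra].
      * intros y1 y2; unfold on_l4, l4_lhs, l4_rhs, p1'; cbn.
        assert (E : y1 + k e c / (k e c + rho e) * y2
                    - (k e c * q1 e + k e c / (k e c + rho e) * c * q2 e)
                    = k e c / (k e c + rho e) *
                      ((k e c + rho e) / k e c * y1 + y2
                       - ((k e c + rho e) * q1 e + c * q2 e))) by (field; lra).
        split; intros H.
        -- rewrite H, Rminus_diag, Rmult_0_r in E; lra.
        -- rewrite H, Rminus_diag in E; symmetry in E.
           apply Rmult_integral in E; destruct E as [E|E]; [|lra].
           assert (0 < k e c / (k e c + rho e)) by (apply Rdiv_lt_0_compat; lra); lra.
    + intros [hck hcx].
      (* [S s] is the number of steps: the prices up to index [s] are still at least
         [p2 - rho], so that consumer II buys at home first in each of these steps *)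
      destruct (g_crossing e c x (c - rho e) he hD hck (Rlt_le _ _ hcx)) as (s & hs & hs').
      destruct (iter_decreases e c x he hD hk0) as [hk hdec].
      assert (RUN : forall t, (t <= S s)%nat ->
                p1 (P t) = Nat.iter t (g e c) x /\ p2 (P t) = c).
      { induction t as [|t IH]; intros Ht; [split; reflexivity|].
        destruct IH as [IH1 IH2]; [lia|].
        destruct (STEP t IH2) as (_ & -> & ->); rewrite ?IH1; auto.
        apply Rle_trans with (1 := hs'), hdec; lia. }
      exists (S s); split; [|split; [|split]].
      * split; [lia|]; rewrite Nat.sub_succ, Nat.sub_0_r; fold x c; lra.
      * fold x c; intros s' (h1 & ha & hb) hne; fold x c in ha, hb.
        (* off the tie, [s'] marks a strict crossing, and a monotone sequence has
           only one *)
        destruct (Nat.lt_trichotomy s' (S s)) as [hlt|[heq|hgt]]; [exfalso|exact heq|exfalso].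
        -- assert (hm : (s' <= s)%nat) by lia; specialize (hdec s' s hm); lra.
        -- assert (hm : (S s <= s' - 1)%nat) by lia; specialize (hdec _ _ hm); lra.
      * intros t Ht; destruct (RUN t) as [R1 R2]; [lia|].
        destruct (STEP t R2) as (D & _ & E); rewrite ?R1; auto.
        -- apply Rle_trans with (1 := hs'), hdec; lia.
        -- split; [exact D|rewrite R2; exact E].
      * destruct (RUN (S s) (le_n _)) as [R1 R2].
        assert (S0 : shift (S s) P 0%nat = P (S s))
          by (unfold shift; rewrite Nat.add_0_r; reflexivity).
        apply HI; rewrite ?S0, ?R1, ?R2; auto.
        -- apply process_shift, HP.
        -- apply (hdec 0%nat); lia.
        -- lra.
Qed.

(** Raising the second price to the residual income of consumer II per unit is what
    the balance equation asks for. *)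
Lemma zone_II_3_adjustment (e : economy) (P : nat -> prices) :
  positive_data e -> price_process e P -> admissible e (P 0%nat) ->
  Y1 e < p1 (P 0%nat) * q1 e ->
  leftover_cost e (P 0%nat) < slack_income e (p2 (P 0%nat)) ->
  up2 e P 0 /\ p1 (P 1%nat) = p1 (P 0%nat) /\
  on_l4 e (P 1%nat) (Y1 e) (Y2 e) /\ l4_equilibrium e (P 1%nat).
Proof.
  intros he HP hp hY hL; unfold slack_income in hL.
  set (p := P 0%nat) in *.
  assert (U : unique (NE e p) (NE_a e p)) by (apply NE_a_unique; auto; lra).
  pose proof (process_step e P 0 _ HP U) as ST; fold p in ST.
  pose proof he as (hq1 & hq2 & hY1 & hY2 & hr).
  pose proof hp as (h1 & h2 & hy1 & hy2).
  assert (ER : Y2res e p (NE_a e p) = Y2 e - leftover_cost e p) by reflexivity.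
  assert (E1 : p1 (P 1%nat) = p1 p).
  { rewrite ST; cbn; apply next_price_stay.
    - unfold q1cons; cbn; lra.
    - unfold Y1res; cbn; lra. }
  assert (E2 : p2 (P 1%nat) = (Y2 e - leftover_cost e p) / q2 e).
  { rewrite ST, <- ER; apply (next_price_up (p2 p)); [unfold q2cons; cbn; lra|lra]. }
  assert (EL : leftover_cost e (P 1%nat) = leftover_cost e p)
    by (unfold leftover_cost, p1'; rewrite E1; reflexivity).
  assert (B : p2 (P 1%nat) * q2 e = Y2 e - leftover_cost e (P 1%nat))
    by (rewrite E2, EL; field; lra).
  assert (hl : 0 < leftover_cost e p) by (apply leftover_pos; auto).
  assert (h22 : 0 <= p2 p * q2 e) by (apply Rmult_le_pos; lra).
  assert (L4 : l4_equilibrium e (P 1%nat)).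
  { apply l4_equilibrium_of_balance; auto; [|rewrite E1; exact hY].
    split; [lra|split; [|split; [rewrite E1; exact hy1|lra]]].
    apply Rmult_le_reg_r with (q2 e); lra. }
  split; [|split; [exact E1|split; [apply L4|exact L4]]].
  exists (NE_a e p); fold p; rewrite ER; split; [apply U|split; [lra|exact E2]].
Qed.

Lemma in_case_b_I_of_zone (e : economy) (Q : nat -> prices) :
  positive_data e -> price_process e Q -> 0 < p1 (Q 0%nat) -> 0 < p2 (Q 0%nat) ->
  zone_II_2 e (Q 0%nat) -> p1 (Q 0%nat) - p2 (Q 0%nat) < - rho e ->
  in_case_b_I e Q.
Proof.
  intros he HQ h1 h2 Z hd.
  pose proof Z as Z'; apply zone_II_2_iff in Z'; auto; destruct Z' as (H & H' & H4 & H1).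
  assert (hp : admissible e (Q 0%nat)) by (repeat split; lra).
  assert (h12 : p1' e (Q 0%nat) < p2 (Q 0%nat)) by (unfold p1'; lra).
  split; [exact Z|split; [exact hd|split]].
  - apply NE_b_I_unique; auto; split; [apply Rlt_le, H4|exact H1].
  - apply pattern_b_I_holds; auto.
Qed.

Lemma in_case_c_I_of_zone (e : economy) (Q : nat -> prices) :
  positive_data e -> price_process e Q -> 0 < p1 (Q 0%nat) -> 0 < p2 (Q 0%nat) ->
  zone_II_1 e (Q 0%nat) -> p1 (Q 0%nat) - p2 (Q 0%nat) < - rho e ->
  in_case_c_I e Q.
Proof.
  intros he HQ h1 h2 Z hd.
  pose proof Z as Z'; apply zone_II_1_iff in Z'; auto; destruct Z' as (H & H' & H1).
  assert (hp : admissible e (Q 0%nat)) by (repeat split; lra).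
  assert (h12 : p1' e (Q 0%nat) < p2 (Q 0%nat)) by (unfold p1'; lra).
  split; [exact Z|split; [exact hd|split]].
  - apply NE_c_I_unique; auto; lra.
  - apply pattern_c_I_holds; auto.
Qed.

Theorem proposition4p3 (e : economy) (p0 : prices)
  (hq1 : 0 < q1 e) (hq2 : 0 < q2 e) (hY1 : 0 < Y1 e) (hY2 : 0 < Y2 e) (hrho : 0 < rho e)
  (hp1 : 0 < p1 p0) (hp2 : 0 < p2 p0)
  (hp : p2 p0 * q2 e < p1 p0 * q1 e)
  (hII : zone_II e p0) :
  (zone_II_1 e p0 /\ ~ zone_II_2 e p0 /\ ~ zone_II_3 e p0 \/
   ~ zone_II_1 e p0 /\ zone_II_2 e p0 /\ ~ zone_II_3 e p0 \/
   ~ zone_II_1 e p0 /\ ~ zone_II_2 e p0 /\ zone_II_3 e p0) /\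
  (exists P, price_process e P /\ P 0%nat = p0) /\
  forall P : nat -> prices, price_process e P -> P 0%nat = p0 ->
    (* a *)
    (zone_II_3 e p0 ->
       unique (NE e p0) (NE_a e p0) /\
       (on_l4 e p0 (Y1 e) (Y2 e) /\ l4_equilibrium e p0 \/
        above_l4 e p0 (Y1 e) (Y2 e) /\
          up2 e P 0 /\ p1 (P 1%nat) = p1 p0 /\
          on_l4 e (P 1%nat) (Y1 e) (Y2 e) /\ l4_equilibrium e (P 1%nat))) /\
    (* b *)
    (zone_II_2 e p0 ->
       (p1 p0 - p2 p0 < - rho e ->
          unique (NE e p0) (NE_b_I e p0) /\ pattern_b_I e P) /\
       (p1 p0 - p2 p0 >= - rho e ->
          unique (NE e p0) (NE_II e p0) /\ pattern_II in_case_b_I e P)) /\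
    (* c *)
    (zone_II_1 e p0 ->
       (p1 p0 - p2 p0 < - rho e ->
          unique (NE e p0) (NE_c_I e p0) /\ pattern_c_I e P) /\
       (p1 p0 - p2 p0 >= - rho e ->
          unique (NE e p0) (NE_II e p0) /\
          pattern_II (fun e P => in_case_b_I e P \/ in_case_c_I e P) e P)).
Proof.
  assert (he : positive_data e) by (repeat split; assumption).
  destruct hII as [hYq h2q].
  assert (hp0 : admissible e p0) by (repeat split; lra).
  pose proof (zone_II_1_iff e p0 he hp1) as Z1.
  pose proof (zone_II_2_iff e p0 he hp1 hp2) as Z2.
  pose proof (zone_II_3_iff e p0 hp2) as Z3.
  pose proof (leftover_pos e p0 he hp1 hYq) as hl.
  assert (h22 : 0 < p2 p0 * q2 e) by (apply Rmult_lt_0_compat; assumption).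
  assert (hs : slack_income e (p2 p0) = Y2 e - p2 p0 * q2 e) by reflexivity.
  split; [|split].
  - rewrite Z1, Z2, Z3.
    destruct (Rlt_le_dec (Y2 e) (leftover_cost e p0));
      [left|right; destruct (Rlt_le_dec (slack_income e (p2 p0)) (leftover_cost e p0));
            [left|right]];
      repeat split; try lra; intros; lra.
  - apply process_exists; assumption.
  - intros P HP E; subst p0; split; [|split].
    + intros H3; apply Z3 in H3; destruct H3 as (_ & h2s & hL).
      split; [apply NE_a_unique; auto; lra|].
      pose proof (l4_gap e (P 0%nat)) as G.
      destruct (Rle_lt_or_eq_dec _ _ hL) as [h|h]; [right|left].
      * split; [unfold above_l4; lra|apply zone_II_3_adjustment; auto].
      * assert (B : p2 (P 0%nat) * q2 e = Y2 e - leftover_cost e (P 0%nat)) by lra.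
        pose proof (l4_equilibrium_of_balance e _ he hp0 hYq B) as L4.
        split; [apply L4|exact L4].
    + intros H2; split; intros hd.
      * destruct (in_case_b_I_of_zone e P) as (_ & _ & U & D); auto.
      * apply Z2 in H2; destruct H2 as (_ & _ & H4 & H1).
        assert (h21 : p2 (P 0%nat) <= p1' e (P 0%nat)) by (unfold p1'; lra).
        split; [apply NE_II_unique; auto; lra|].
        apply pattern_II_holds; auto; [lra|apply k_below_iff; auto; lra|].
        intros Q HQ EQ hk hle hdQ.
        pose proof (k_pos e (p2 (Q 0%nat)) he) as hk0.
        assert (hD : 0 <= slack_income e (p2 (Q 0%nat))) by (rewrite EQ; lra).
        pose proof (k_income e _ _ he hD hk) as hYQ.
        apply in_case_b_I_of_zone; auto; try lra.
        apply zone_II_2_iff; auto; try lra.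
        split; [exact hYQ|split; [rewrite EQ; exact h2q|split]].
        -- apply k_below_iff; auto; lra.
        -- apply Rle_trans with (2 := H1), leftover_increasing; auto; lra.
    + intros H1; split; intros hd.
      * destruct (in_case_c_I_of_zone e P) as (_ & _ & U & D); auto.
      * apply Z1 in H1; destruct H1 as (_ & _ & H1).
        assert (h21 : p2 (P 0%nat) <= p1' e (P 0%nat)) by (unfold p1'; lra).
        split; [apply NE_II_unique; auto; lra|].
        apply pattern_II_holds; auto; [lra|apply k_below_iff; auto; lra|].
        intros Q HQ EQ hk hle hdQ.
        pose proof (k_pos e (p2 (Q 0%nat)) he) as hk0.
        assert (hD : 0 <= slack_income e (p2 (Q 0%nat))) by (rewrite EQ; lra).
        pose proof (k_income e _ _ he hD hk) as hYQ.
        destruct (Rlt_le_dec (Y2 e) (leftover_cost e (Q 0%nat))) as [hL|hL].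
        -- right; apply in_case_c_I_of_zone; auto; try lra.
           apply zone_II_1_iff; auto; try lra.
           split; [exact hYQ|split; [rewrite EQ; exact h2q|exact hL]].
        -- left; apply in_case_b_I_of_zone; auto; try lra.
           apply zone_II_2_iff; auto; try lra.
           split; [exact hYQ|split; [rewrite EQ; exact h2q|split; [|exact hL]]].
           apply k_below_iff; auto; lra.
Qed.
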